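(* For any $s\ge0$, $\sigma\ge0$ there exist strictly positive constants $R_{s,\sigma}$, $C_{s,\sigma}$ with the following property. Consider the solution $v(t)\equiv(X(t),Y(t))$ of the Toda lattice (with $N$ particles, $N\ge2$) corresponding to an initial datum $v_0\in B^{s,\sigma}(R/N^2)$ with $R\le R_{s,\sigma}$; then one has $$v(t)\in B^{s,\sigma}\Big(\frac R{N^2}\big(1+C_{s,\sigma}R\big)\Big),\qquad\forall t\in\mathbb R.$$
   Context: Toda lattice. For an integer $N\ge2$ let $H_{Toda}(p,q)=\frac12\sum_{j=0}^{N-1}p_j^2+\sum_{j=0}^{N-1}e^{q_j-q_{j+1}}$ with periodic boundary conditions $q_N=q_0$, $p_N=p_0$, restricted to the invariant subspace $\sum_jq_j=0=\sum_jp_j$. Discrete Fourier transform: $\hat q_k=\frac1{\sqrt N}\sum_{j=0}^{N-1}q_je^{2\pi \mathrm i jk/N}$ ($N$-periodic in $k$), similarly $\hat p_k$. Put $\omega_k=\omega(k/N)=2\sin(k\pi/N)$ and, for $1\le k\le N-1$, $$\xi_k=\frac{\hat p_k+\mathrm i\omega_k\hat q_k}{\sqrt{2\omega_k}},\quad \eta_k=\frac{\hat p_{N-k}-\mathrm i\omega_k\hat q_{N-k}}{\sqrt{2\omega_k}},\quad X_k=\frac{\xi_k+\eta_k}{\sqrt2},\quad Y_k=\frac{\xi_k-\eta_k}{\mathrm i\sqrt2}.$$ The solutions are expressed in the coordinates $(X,Y)$. Norms. $[k]_N=\min(|k|,|N-k|)$. $\|(X,Y)\|^2_{\mathcal P^{s,\sigma}}=\frac1N\sum_{k=1}^{N-1}[k]_N^{2s}e^{2\sigma[k]_N}\omega_k\frac{|X_k|^2+|Y_k|^2}2$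 on $\mathbb C^{N-1}\times\mathbb C^{N-1}$, and $B^{s,\sigma}(R)$ is the ball of radius $R$ centered at $0$ in $\mathbb C^{N-1}\times\mathbb C^{N-1}$ for this norm. The constants $R_{s,\sigma},C_{s,\sigma}$ do not depend on $N$. *)

(* Defs.v *)
From HB Require Import structures.
From mathcomp Require Import all_boot all_order all_algebra.
From mathcomp Require Import all_classical all_reals all_analysis.
From mathcomp Require Export complex.

Set Implicit Arguments.
Unset Strict Implicit.
Unset Printing Implicit Defensive.

Import Order.TTheory GRing.Theory Num.Theory.
Import numFieldNormedType.Exports.
Local Open Scope classical_set_scope.
Local Open Scope ring_scope.
Local Open Scope complex_scope.

Section Toda.
Variables (R : realType) (N : nat).

(* Index arithmetic is modulo N: [ordS j] is j + 1, with ordS (N - 1) = 0. *)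
Definition toda_hamiltonian (p q : 'rV[R]_N) : R :=
  2^-1 * (\sum_(j < N) p ord0 j ^+ 2) +
  \sum_(j < N) expR (q ord0 j - q ord0 (ordS j)).

Definition zero_sum (x : 'rV[R]_N) : Prop := \sum_(j < N) x ord0 j = 0.

(* Hamilton's equations of the full system, on the invariant subspace of zero
   total position and zero total momentum. *)
Definition toda_solution (p q : R -> 'rV[R]_N) : Prop :=
  forall t : R,
    [/\ zero_sum (p t), zero_sum (q t)
      & forall j : 'I_N,
          is_derive t 1 (fun u => q u ord0 j)
            ('D_(delta_mx ord0 j) (fun y => toda_hamiltonian y (q t)) (p t)) /\
          is_derive t 1 (fun u => p u ord0 j)
            (- 'D_(delta_mx ord0 j) (fun x => toda_hamiltonian (p t) x) (q t))].

Definition cis (x : R) : R[i] := cos x +i* sin x.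

Definition dft (x : 'rV[R]_N) (k : nat) : R[i] :=
  (Num.sqrt N%:R)^-1%:C *
  \sum_(j < N) (x ord0 j)%:C * cis (2 * pi * j%:R * k%:R / N%:R).

Definition omega (k : nat) : R := 2 * sin (k%:R * pi / N%:R).

Definition xi (p q : 'rV[R]_N) (k : nat) : R[i] :=
  (dft p k + 'i%C * (omega k)%:C * dft q k) / (Num.sqrt (2 * omega k))%:C.

Definition eta (p q : 'rV[R]_N) (k : nat) : R[i] :=
  (dft p (N - k) - 'i%C * (omega k)%:C * dft q (N - k)) /
  (Num.sqrt (2 * omega k))%:C.

Definition coordX (p q : 'rV[R]_N) (k : nat) : R[i] :=
  (xi p q k + eta p q k) / (Num.sqrt 2)%:C.

Definition coordY (p q : 'rV[R]_N) (k : nat) : R[i] :=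
  (xi p q k - eta p q k) / ('i%C * (Num.sqrt 2)%:C).

(* C^(N-1) x C^(N-1); column i : 'I_N.-1 holds the mode k = i + 1, so that k
   ranges over 1, ..., N - 1. *)
Definition phase_space : Type := ('rV[R[i]]_N.-1 * 'rV[R[i]]_N.-1)%type.

Definition toda_coord (p q : 'rV[R]_N) : phase_space :=
  (\row_(i < N.-1) coordX p q i.+1, \row_(i < N.-1) coordY p q i.+1).

(* min(|k|, |N - k|) for 0 <= k <= N *)
Definition bracket (k : nat) : nat := minn k (N - k).

Definition phase_norm (s sigma : R) (v : phase_space) : R :=
  Num.sqrt (N%:R^-1 *
    \sum_(i < N.-1)
      powR (bracket i.+1)%:R (2 * s) * expR (2 * sigma * (bracket i.+1)%:R) *
      omega i.+1 *
      ((Normc.normc (v.1 ord0 i) ^+ 2 + Normc.normc (v.2 ord0 i) ^+ 2) / 2)).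

Definition phase_ball (s sigma r : R) : set phase_space :=
  [set v | phase_norm s sigma v < r].

End Toda.

(* Main.v *)
(* The spectrum of the Lax matrix of the lattice is constant in time. In the
   Fourier basis the Lax matrix with Floquet phase e^(i pi k / N) is D + V, where
   D has the double level D_0 = D_k = 2 cos (k pi / N), isolated from the other
   levels by at least 4 [l] [k - l] / N^2, and the coupling V_(0 k) between the
   two resonant modes is, to first order, proportional to the normal mode
   p^_k + i omega_k q^_k. A Schur complement on these two modes shows that the
   width of the pair of eigenvalues near D_0 is 2 |V_(0 k)| up to an error which,
   by convolution estimates in weighted l^2 spaces, is of relative size
   N^2 |V| ~ r, uniformly in N. As the width is conserved, so is the phase norm
   up to a factor 1 + O(r), provided it remains of order r / N^2; continuity in
   time removes this proviso. *)
Require Import Defs.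
From mathcomp Require Import all_boot all_order all_algebra.
From mathcomp Require Import all_classical all_reals all_analysis.
From mathcomp Require Import ring lra zify.

Set Implicit Arguments.
Unset Strict Implicit.
Unset Printing Implicit Defensive.

Import Order.TTheory GRing.Theory Num.Theory.
Import numFieldNormedType.Exports.
Local Open Scope classical_set_scope.
Local Open Scope ring_scope.
Local Open Scope complex_scope.
Import Normc.

(** * Weighted convolution estimates *)

Section EuclideanNorm.
Variables (R : realType) (I : finType).
Implicit Types f g : I -> R.

(** The weight [W k] may grow exponentially, so the error on the coupling of the pair (0, k) must
    decay in k like the coupling itself. The level shift A produced by the Schur complement need not
    decay. It is harmless because both modes of the pair receive the same real shift: the phase
    makes the perturbed matrix invariant under l -> k - l composed with complex conjugation. The
    eigenvalue equation is then |lam - D_0 - A(lam)| = |beta(lam)|, and in the difference of two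
    roots only the variation of A in lam survives, which costs a relative error. Uniformity in N
    comes from the product form of the gap. Dividing by it leaves two inverse brackets, whose l^2
    norm is bounded independently of N. One turns an l^2 function into an l^1 function, the other
    turns a constant into an l^2 function, as Young's inequality requires. The only loss is the
    factor N^2, which the radius R / N^2 compensates. *)

Definition l2norm f : R := Num.sqrt (\sum_i f i ^+ 2).

Lemma l2norm_ge0 f : 0 <= l2norm f.
Proof. exact: sqrtr_ge0. Qed.

Lemma sqr_l2norm f : l2norm f ^+ 2 = \sum_i f i ^+ 2.
Proof. by rewrite sqr_sqrtr ?sumr_ge0 // => i _; rewrite sqr_ge0. Qed.

(** By Lagrange's identity, twice the defect is the double sum of the squares
    [(f i * g j - f j * g i) ^+ 2]. *)
Lemma cauchy_schwarz_sum f g :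
  (\sum_i f i * g i) ^+ 2 <= (\sum_i f i ^+ 2) * (\sum_i g i ^+ 2).
Proof.
have : 0 <= \sum_i \sum_j (f i * g j - f j * g i) ^+ 2.
  by apply: sumr_ge0 => i _; apply: sumr_ge0 => j _; rewrite sqr_ge0.
suff -> : \sum_i \sum_j (f i * g j - f j * g i) ^+ 2 =
  ((\sum_i f i ^+ 2) * (\sum_i g i ^+ 2) - (\sum_i f i * g i) ^+ 2) *+ 2.
  by rewrite pmulrn_lge0 // subr_ge0.
have sqE i j : (f i * g j - f j * g i) ^+ 2 = f i ^+ 2 * g j ^+ 2 +
    g i ^+ 2 * f j ^+ 2 - (f i * g i) * (f j * g j) *+ 2 by ring.
under eq_bigr => i _ do under eq_bigr => j _ do rewrite sqE.
under eq_bigr => i _ do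
  rewrite sumrB big_split /= -!mulr_sumr sumrMnl -mulr_sumr.
rewrite sumrB big_split /= -!mulr_suml sumrMnl -mulr_suml.
by ring.
Qed.

Lemma sum_mul_le_l2norm f g : \sum_i f i * g i <= l2norm f * l2norm g.
Proof.
apply: le_trans (ler_norm _) _.
rewrite -(@ler_pXn2r _ 2) ?nnegrE ?mulr_ge0 ?l2norm_ge0 //.
by rewrite exprMn !sqr_l2norm real_normK ?num_real // cauchy_schwarz_sum.
Qed.

Lemma eq_l2norm f g : f =1 g -> l2norm f = l2norm g.
Proof. by move=> e; congr Num.sqrt; apply: eq_bigr => i _; rewrite e. Qed.

Lemma l2normD f g : l2norm (fun i => f i + g i) <= l2norm f + l2norm g.
Proof.
rewrite -(@ler_pXn2r _ 2) ?nnegrE ?addr_ge0 ?l2norm_ge0 //.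
rewrite sqrrD !sqr_l2norm.
under eq_bigr => i _ do rewrite sqrrD.
rewrite !big_split /= -mulr2n lerD2r lerD2l ler_pMn2r //.
exact: sum_mul_le_l2norm.
Qed.

Lemma l2norm_le f g : (forall i, `|f i| <= g i) -> l2norm f <= l2norm g.
Proof.
move=> fg; rewrite ler_sqrt; last by apply: sumr_ge0 => i _; rewrite sqr_ge0.
apply: ler_sum => i _; rewrite -(real_normK (num_real (f i))).
by rewrite ler_pXn2r ?nnegrE // (le_trans _ (fg i)).
Qed.

Lemma l2normZ c f : 0 <= c -> l2norm (fun i => c * f i) = c * l2norm f.
Proof.
move=> c0; rewrite /l2norm.
under eq_bigr => i _ do rewrite exprMn.
by rewrite -mulr_sumr sqrtrM ?sqr_ge0 // sqrtr_sqr ger0_norm.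
Qed.

Lemma le_l2norm f i : `|f i| <= l2norm f.
Proof.
rewrite -sqrtr_sqr ler_sqrt; last by apply: sumr_ge0 => j _; rewrite sqr_ge0.
by rewrite (bigD1 i) //= lerDl sumr_ge0 // => j _; rewrite sqr_ge0.
Qed.

Lemma sum_le_sqrt_card f : \sum_i f i <= Num.sqrt #|I|%:R * l2norm f.
Proof.
have := sum_mul_le_l2norm (fun=> 1) f.
rewrite (eq_bigr f) => [|i _]; last by rewrite mul1r.
by rewrite {1}/l2norm expr1n sumr_const.
Qed.

End EuclideanNorm.

Section Convolution.
Variables (R : realType) (I : finZmodType).
Implicit Types f g : I -> R.

Lemma l2norm_reflect f k : l2norm (fun l => f (k - l)) = l2norm f.
Proof.
rewrite /l2norm [in RHS](reindex_inj (inv_inj (subKr k))) //.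
Qed.

Lemma l2norm_opp f : l2norm (fun l => f (- l)) = l2norm f.
Proof. by rewrite /l2norm [in RHS](reindex_inj oppr_inj). Qed.

(** Splitting [f l] into two square roots, Cauchy-Schwarz bounds the square of each entry by
    [\sum_l f l] times the convolution of [f] with [g ^+ 2]; translation invariance then sums over
    [k]. *)
Lemma young_l1_l2 f g : (forall i, 0 <= f i) -> (forall i, 0 <= g i) ->
  l2norm (fun k => \sum_l f l * g (k - l)) <= (\sum_l f l) * l2norm g.
Proof.
move=> f0 g0.
have F0 : 0 <= \sum_l f l by apply: sumr_ge0.
rewrite -(@ler_pXn2r _ 2) ?nnegrE ?mulr_ge0 ?l2norm_ge0 // exprMn !sqr_l2norm.
have H k : (\sum_l f l * g (k - l)) ^+ 2 <=
    (\sum_l f l) * \sum_l f l * g (k - l) ^+ 2.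
  have := cauchy_schwarz_sum (fun l => Num.sqrt (f l))
    (fun l => Num.sqrt (f l) * g (k - l)).
  rewrite (eq_bigr (fun l => f l * g (k - l))) => [|i _]; last first.
    by rewrite mulrA -expr2 sqr_sqrtr.
  move/le_trans; apply; rewrite le_eqVlt; apply/orP; left; apply/eqP.
  by congr (_ * _); apply: eq_bigr => i _; rewrite ?exprMn sqr_sqrtr.
apply: le_trans (ler_sum _ (fun k _ => H k)) _.
rewrite -mulr_sumr exchange_big /= [leRHS](_ : _ = (\sum_l f l) *
  \sum_l f l * \sum_i g i ^+ 2); last by rewrite -mulr_suml mulrA expr2.
rewrite ler_wpM2l // ler_sum // => l _.
by rewrite -mulr_sumr [in leRHS](reindex_inj (addIr (- l))).
Qed.

End Convolution.

(** * Distance to zero on the cyclic group and submultiplicative weights *)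

Section Bracket.
Variable n : nat.
Local Notation N := n.+2.
Implicit Types x y : 'I_n.+2.

Lemma bracket0 : bracket N 0 = 0%N.
Proof. by rewrite /bracket min0n. Qed.

Lemma bracket_gt0 x : x != 0 -> (0 < bracket N x)%N.
Proof.
move=> x0; rewrite /bracket leq_min subn_gt0 ltn_ord andbT lt0n.
by apply: contra_neq x0 => x0; apply: val_inj.
Qed.

Lemma val_oppI x : x != 0 -> (- x : 'I_N) = (N - x)%N :> nat.
Proof.
move=> x0 /=; rewrite modn_small // ltn_subrL lt0n andbT.
by apply: contra_neq x0 => x0; apply: val_inj.
Qed.

Lemma bracketN x : bracket N (- x) = bracket N x.
Proof.
have [->|x0] := eqVneq x 0; first by rewrite oppr0.
by rewrite val_oppI // /bracket subKn 1?minnC // ltnW.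
Qed.

Lemma bracketD x y : (bracket N (x + y)%R <= bracket N x + bracket N y)%N.
Proof.
rewrite /bracket /=; have xN := ltn_ord x; have yN := ltn_ord y.
case: (ltnP (x + y) N) => xy.
  rewrite modn_small //; move: xN yN xy; rewrite /minn; do 3!case: ifP; lia.
have -> : ((x + y) %% N = x + y - N)%N.
  by rewrite -{1}(subnK xy) modnDr modn_small // ltn_subLR //; lia.
move: xN yN xy; rewrite /minn; do 3!case: ifP; lia.
Qed.

End Bracket.

Section Weight.
Variables (R : realType) (s sigma : R) (n : nat).
Hypotheses (hs : 0 <= s) (hsigma : 0 <= sigma).
Local Notation N := n.+2.
Implicit Types x y : 'I_n.+2.

(* Replacing [x]_N by max(1, [x]_N) makes the weight defined and
   submultiplicative also at the zero mode. *)
Definition weight x : R :=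
  powR (maxn 1 (bracket N x))%:R s * expR (sigma * (bracket N x)%:R).

Lemma weight_ge1 x : 1 <= weight x.
Proof.
rewrite /weight -[leLHS]mulr1 ler_pM //.
  have m1 : 1 <= (maxn 1 (bracket N x))%:R :> R by rewrite ler1n leq_maxl.
  by have := ler_powR m1 hs; rewrite powRr0.
by rewrite -expR0 ler_expR mulr_ge0.
Qed.

Lemma weight_gt0 x : 0 < weight x.
Proof. exact: lt_le_trans (weight_ge1 x). Qed.

Lemma weightN x : weight (- x) = weight x.
Proof. by rewrite /weight bracketN. Qed.

(** The bracket is subadditive, so the exponential costs nothing; the power costs 2^s because max(1,
    a + b) <= 2 max(1, a) max(1, b). *)
Lemma weightD x y : weight (x + y) <= powR 2 s * weight x * weight y.
Proof.
rewrite /weight.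
set a := bracket N x; set b := bracket N y; set c := bracket N (x + y)%R.
have cab : (c <= a + b)%N by exact: bracketD.
rewrite (_ : _ * _ * _ = (powR 2 s * powR (maxn 1 a)%:R s * powR (maxn 1 b)%:R s) *
  (expR (sigma * a%:R) * expR (sigma * b%:R))); last by ring.
rewrite -!powRM ?mulr_ge0 // -!natrM -expRD -mulrDr -natrD.
apply: ler_pM; rewrite ?powR_ge0 ?expR_ge0 //.
  apply: ge0_ler_powR; rewrite ?nnegrE // ler_nat.
  suff : (maxn 1 (a + b) <= 2 * maxn 1 a * maxn 1 b)%N.
    by apply: leq_trans; rewrite geq_max leq_maxl (leq_trans cab) ?leq_maxr.
  by rewrite /maxn; do 3!case: ifP; nia.
by rewrite ler_expR ler_wpM2l // ler_nat.
Qed.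

Lemma weight_sub x y : weight x <= powR 2 s * weight y * weight (x - y).
Proof. by rewrite -{1}(subrK y x) mulrAC; exact: weightD. Qed.

(* Vanishes at x = 0, since 0^-1 = 0. *)
Definition inv_bracket x : R := (bracket N x)%:R^-1.

Lemma inv_bracket_ge0 x : 0 <= inv_bracket x.
Proof. by rewrite invr_ge0. Qed.

Lemma inv_bracket_le1 x : inv_bracket x <= 1.
Proof.
rewrite /inv_bracket; case: (bracket N x) => [|m]; first by rewrite invr0.
by rewrite invf_le1 ?ler1n ?ltr0n.
Qed.

Lemma sum_inv_sqr_le m : \sum_(i < m) (i%:R ^+ 2 : R)^-1 <= 2.
Proof.
case: m => [|m]; first by rewrite big_ord0.
rewrite big_ord_recl expr0n invr0 add0r.
case: m => [|m]; first by rewrite big_ord0.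
(* The bound 2 is strengthened to 2 - 1/m, which is inductive since 1/(m+1)^2 <= 1/m - 1/(m+1). The
   index 0 has contributed 0^-1 = 0. *)
suff H : \sum_(i < m.+1) ((i.+1)%:R ^+ 2 : R)^-1 <= 2 - m.+1%:R^-1.
  by apply: le_trans H _; rewrite lerBlDr lerDl invr_ge0.
elim: m => [|m IH]; first by rewrite big_ord_recl big_ord0 expr1n invr1; lra.
rewrite big_ord_recr /=; apply: le_trans (lerD IH (lexx _)) _.
rewrite -(natr1 m.+1).
have m0 : 0 < m.+1%:R :> R by [].
move: m0; set t := m.+1%:R => m0.
have t0 : t != 0 by rewrite gt_eqF.
have t1 : t + 1 != 0 by rewrite gt_eqF // addr_gt0.
rewrite -subr_ge0 (_ : _ - _ = (t * (t + 1) ^+ 2)^-1); last by field; apply/andP.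
by rewrite invr_ge0 mulr_ge0 ?exprn_ge0 ?addr_ge0 ?(ltW m0).
Qed.

Lemma l2norm_inv_bracket : l2norm inv_bracket <= 2.
Proof.
have -> : 2 = Num.sqrt 4 :> R.
  by rewrite (_ : 4 = 2 ^+ 2) ?sqrtr_sqr ?ger0_norm //; ring.
rewrite ler_sqrt //.
(* The bracket is x or N - x, so its inverse square is one of the two terms; each of the two sums is
   at most 2, whence 4. *)
apply: (@le_trans _ _ (\sum_(x < N) ((x%:R ^+ 2)^-1 + ((- x)%R%:R ^+ 2)^-1))).
  apply: ler_sum => x _; rewrite /inv_bracket exprVn.
  have [->|x0] := eqVneq x 0.
    by rewrite bracket0 oppr0 expr0n invr0 addr0.
  rewrite val_oppI // /bracket /minn; case: ifP => _.
    by rewrite lerDl invr_ge0 sqr_ge0.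
  by rewrite lerDr invr_ge0 sqr_ge0.
rewrite big_split /= [X in _ + X](_ : _ = \sum_(x < N) (x%:R ^+ 2)^-1).
  by have := sum_inv_sqr_le N; lra.
by rewrite [RHS](reindex_inj oppr_inj).
Qed.

End Weight.

(** * The complex modulus *)

Section ComplexModulus.
Variable R : realType.
Implicit Types z w : R[i].

Lemma normc_ge0 z : 0 <= normc z.
Proof. by case: z => a b; exact: sqrtr_ge0. Qed.

Lemma normc_add z w : normc (z + w) <= normc z + normc w.
Proof. exact: (@le_normcD R). Qed.

Lemma normc_opp z : normc (- z) = normc z.
Proof. exact: (@normcN R). Qed.

Lemma normc_sum (I : finType) (F : I -> R[i]) :
  normc (\sum_i F i) <= \sum_i normc (F i).
Proof.
elim/big_rec2: _ => [|i x y _ h]; first by rewrite normc0.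
by apply: le_trans (normc_add _ _) _; rewrite lerD2l.
Qed.

Lemma normc_real (x : R) : normc x%:C = `|x|.
Proof. by rewrite /normc /= expr0n addr0 sqrtr_sqr. Qed.

Lemma real_complexB (x y : R) : (x - y)%:C = x%:C - y%:C.
Proof. exact: rmorphB. Qed.

Lemma real_complexD (x y : R) : (x + y)%:C = x%:C + y%:C.
Proof. exact: rmorphD. Qed.

Lemma real_complexM (x y : R) : (x * y)%:C = x%:C * y%:C.
Proof. exact: rmorphM. Qed.

Lemma real_complex_sum (I : finType) (F : I -> R) :
  (\sum_i F i)%:C = \sum_i (F i)%:C.
Proof. exact: rmorph_sum. Qed.

Lemma conjcM z w : (z * w)^*%C = z^*%C * w^*%C.
Proof. exact: rmorphM. Qed.

Lemma conjcD z w : (z + w)^*%C = z^*%C + w^*%C.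
Proof. exact: rmorphD. Qed.

Lemma conjcB z w : (z - w)^*%C = z^*%C - w^*%C.
Proof. exact: rmorphB. Qed.

Lemma conjcMn z m : (z *+ m)^*%C = z^*%C *+ m.
Proof. exact: raddfMn. Qed.

Lemma conjc_sum (I : finType) (F : I -> R[i]) :
  (\sum_i F i)^*%C = \sum_i (F i)^*%C.
Proof. exact: rmorph_sum. Qed.

Lemma normc_conj z : normc z^*%C = normc z.
Proof. by case: z => a b; rewrite /= sqrrN. Qed.

Lemma sqr_normc z : normc z ^+ 2 = complex.Re z ^+ 2 + complex.Im z ^+ 2.
Proof. by case: z => a b; rewrite sqr_sqrtr // addr_ge0 ?sqr_ge0. Qed.

Lemma mul_conjc_normc z : z * z^*%C = (normc z ^+ 2)%:C.
Proof.
rewrite sqr_normc; case: z => a b; apply/eqP; rewrite eq_complex /=.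
by rewrite mulrN opprK -!expr2 eqxx /= mulrN mulrC addNr.
Qed.

Lemma normc_sub z w : `|normc z - normc w| <= normc (z - w).
Proof.
rewrite ler_norml; apply/andP; split.
  rewrite lerNl opprB lerBlDr -(normc_opp (z - w)) opprB.
  by apply: le_trans (normc_add _ _); rewrite subrK.
by rewrite lerBlDr; apply: le_trans (normc_add _ _); rewrite subrK.
Qed.

End ComplexModulus.

(** * Width of a pair of roots of a Lipschitz equation *)

Section LipschitzRoot.
Variable R : realType.

Lemma lipschitz_root (f : R -> R) (a b K : R) : a <= b -> 0 <= K ->
  (forall x y, a <= x <= b -> a <= y <= b -> `|f x - f y| <= K * `|x - y|) ->
  f a <= 0 -> 0 <= f b -> exists2 c, a <= c <= b & f c = 0.
Proof.
move=> ab K0 lip fa fb.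
(* Clamping to [a, b] is 1-Lipschitz, so it extends [f] to a continuous function on the whole line,
   to which the intermediate value theorem applies. *)
pose cl (x : R) := Num.max a (Num.min b x).
have clin x : a <= cl x <= b.
  by rewrite /cl le_max lexx /= ge_max ab ge_min lexx.
have clid x : a <= x <= b -> cl x = x.
  by case/andP=> ax xb; rewrite /cl (min_idPr xb) (max_idPr ax).
have cl_mono x y : x <= y -> 0 <= cl y - cl x <= y - x.
  move=> xy; rewrite /cl.
  by case: (leP b x) => ?; case: (leP b y) => ?; case: (leP a _) => ?;
    try (case: (leP a _) => ?); lra.
have cl_lip x y : `|cl x - cl y| <= `|x - y|.
  wlog xy : x y / y <= x => [H|].
    by case: (leP y x) => [/H//|/ltW /H]; rewrite distrC (distrC y).
  have /andP[h1 h2] := cl_mono _ _ xy.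
  by rewrite !ger0_norm // subr_ge0.
pose g x := f (cl x).
have gc : continuous g.
  have K1 : 0 < K + 1 by rewrite ltr_wpDl.
  move=> x; apply/cvgrPdist_le => e e0.
  have e1 : 0 < (K + 1)^-1 * e by rewrite mulr_gt0 ?invr_gt0.
  apply: filterS (nbhsx_ballx x _ e1) => y; rewrite /ball /= => /ltW xy.
  apply: le_trans (lip _ _ (clin _) (clin _)) _.
  apply: le_trans (ler_wpM2l K0 (cl_lip _ _)) _.
  apply: (@le_trans _ _ ((K + 1) * `|x - y|)); first by rewrite ler_wpM2r ?lerDl.
  by rewrite -ler_pdivlMl.
have [||c cab gc0] := @IVT R g a b 0 ab.
- exact: continuous_subspaceT.
- by rewrite /g !clid ?lexx ?ab // ge_min fa le_max fb orbT.
exists c; first by move: cab; rewrite in_itv.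
by rewrite -gc0 /g clid //; move: cab; rewrite in_itv.
Qed.

End LipschitzRoot.

Section Cluster.
Variables (R : realType) (E : R -> Prop) (A b : R -> R) (D0 d c e kap : R).
Hypotheses (d_ge0 : 0 <= d) (kap_ge0 : 0 <= kap) (b_ge0 : forall lam, 0 <= b lam).
Hypothesis E_A : forall lam, `|lam - D0| <= d ->
  E lam <-> `|lam - D0 - A lam| = b lam.
Hypothesis A_b_small : forall lam, `|lam - D0| <= d -> `|A lam| + b lam <= d.
Hypothesis b_close : forall lam, `|lam - D0| <= d -> `|b lam - c| <= e.
Hypothesis A_lip : forall lam mu, `|lam - D0| <= d -> `|mu - D0| <= d ->
  `|A lam - A mu| <= kap * `|lam - mu|.
Hypothesis b_lip : forall lam mu, `|lam - D0| <= d -> `|mu - D0| <= d ->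
  `|b lam - b mu| <= 4 * `|lam - mu|.

(** Subtracting the relations of the two roots cancels [D0] and leaves only the variation of [A],
    however large [A] itself is. *)
Lemma lipschitz_width_upper lam mu :
  `|lam - D0| <= d -> `|mu - D0| <= d -> E lam -> E mu ->
  (1 - kap) * `|lam - mu| <= 2 * (c + e).
Proof.
move=> hl hm /(E_A hl) h5 /(E_A hm) h4.
have := b_close hl; have := b_close hm; have := A_lip hl hm.
move=> h1; rewrite !ler_norml => /andP[_ h2] /andP[_ h3].
have : `|lam - mu| <= `|lam - D0 - A lam| + `|mu - D0 - A mu| + `|A lam - A mu|.
  rewrite [X in `|X| <= _](_ : lam - mu =
    (lam - D0 - A lam) - (mu - D0 - A mu) + (A lam - A mu)); last by ring.
  by apply: le_trans (ler_normD _ _) _; rewrite lerD2r ler_normB.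
by rewrite h4 h5 => h6; rewrite mulrBl mul1r; lra.
Qed.

(** By [A_b_small] the difference of the two sides changes sign over the window. The constant 4 in
    [b_lip] serves only this existence argument and does not enter the width. *)
Lemma cluster_root (sg : R) : `|sg| = 1 ->
  exists2 lam, `|lam - D0| <= d & lam - D0 - A lam = sg * b lam.
Proof.
move=> sg1; have d0 := d_ge0.
have near_itv (lam : R) : D0 - d <= lam <= D0 + d -> `|lam - D0| <= d.
  by rewrite ler_norml => /andP[h1 h2]; apply/andP; split; lra.
have bound lam : `|lam - D0| <= d -> `|A lam + sg * b lam| <= d.
  move=> hl; apply: le_trans (ler_normD _ _) _.
  by rewrite normrM sg1 mul1r (ger0_norm (b_ge0 _)) A_b_small.
have [|||||lam hl h] := @lipschitz_root R
  (fun lam => lam - D0 - A lam - sg * b lam) (D0 - d) (D0 + d) (1 + kap + 4).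
- by lra.
- by rewrite !addr_ge0.
- move=> x y /near_itv hx /near_itv hy.
  rewrite (_ : _ - _ = (x - y) - (A x - A y) - sg * (b x - b y)); last by ring.
  apply: le_trans (ler_normB _ _) _; rewrite [in leRHS]mulrDl; apply: lerD.
    by apply: le_trans (ler_normB _ _) _; rewrite mulrDl mul1r lerD2l A_lip.
  by rewrite normrM sg1 mul1r b_lip.
- have h : `|D0 - d - D0| <= d by rewrite addrAC subrr sub0r normrN ger0_norm.
  by have := bound _ h; rewrite ler_norml => /andP[h1 h2]; lra.
- have h : `|D0 + d - D0| <= d by rewrite addrAC subrr add0r ger0_norm.
  by have := bound _ h; rewrite ler_norml => /andP[h1 h2]; lra.
exists lam; first exact: near_itv.
by move/eqP: h; rewrite subr_eq0 => /eqP.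
Qed.

(** The roots for the signs 1 and -1 are the two ends of the pair: their signed difference is
    [b lam + b mu] plus the variation of [A]. *)
Lemma lipschitz_width_lower : exists lam mu : R,
  [/\ `|lam - D0| <= d, `|mu - D0| <= d, E lam, E mu &
      2 * (c - e) <= (1 + kap) * `|lam - mu|].
Proof.
have [lam hl el] := cluster_root (normr1 R).
have [mu hm em] := cluster_root (normrN1 R).
exists lam, mu; split=> //.
- by apply/(E_A hl); rewrite el mul1r ger0_norm.
- by apply/(E_A hm); rewrite em mulN1r normrN ger0_norm.
have := b_close hl; have := b_close hm; have := A_lip hl hm.
move: el em; rewrite mul1r mulN1r.
move=> e1 e2; rewrite !ler_norml => /andP[h1 _] /andP[h2 _] /andP[h3 _].
by have := ler_norm (lam - mu) => h4; rewrite mulrDl mul1r; lra.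
Qed.

End Cluster.

(** * Schur complement on a resonant pair of modes *)

Section Feshbach.
Variables (R : realType) (n : nat).
Local Notation N := n.+2.
Variables (D : 'I_n.+2 -> R) (V : 'I_n.+2 -> 'I_n.+2 -> R[i]).

Definition is_eigenvalue (lam : R) : Prop :=
  exists phi : 'I_n.+2 -> R[i], (exists l, phi l != 0) /\
    forall l, (D l)%:C * phi l + \sum_m V l m * phi m = lam%:C * phi l.

Variables (k : 'I_n.+2) (v : 'I_n.+2 -> R).
Variables (s sigma : R).
Hypotheses (hs : 0 <= s) (hsigma : 0 <= sigma).
Local Notation W := (@weight R s sigma n).
Local Notation ib := (@inv_bracket R n).
Hypothesis k0 : k != 0.
Hypothesis D_refl : forall l : 'I_n.+2, D (k - l) = D l.
Hypothesis D_gap : forall l : 'I_n.+2,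
  4 * (bracket N l)%:R * (bracket N (k - l)%R)%:R / N%:R ^+ 2 <= `|D 0 - D l|.
Hypothesis V_herm : forall l m, V l m = (V m l)^*%C.
Hypothesis V_refl : forall l m : 'I_n.+2, V (k - l) (k - m) = (V l m)^*%C.
Hypothesis v_ge0 : forall l, 0 <= v l.
Hypothesis vN : forall l : 'I_n.+2, v (- l) = v l.
Hypothesis V_bound : forall l m : 'I_n.+2, normc (V l m) <= v (l - m).

Let nu : R := l2norm (fun l => W l * v l).
Let kap0 : R := N%:R ^+ 2 * nu * powR 2 s.
Hypothesis small : kap0 <= 8^-1.

Let nu_ge0 : 0 <= nu. Proof. exact: l2norm_ge0. Qed.
Let N2_gt0 : 0 < (N%:R : R) ^+ 2. Proof. by rewrite exprn_gt0 // ltr0n. Qed.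
Let N22_ge0 : 0 <= (N%:R : R) ^+ 2 / 2. Proof. by rewrite divr_ge0 // ltW. Qed.
Let c2 : 1 <= powR 2 s :> R.
Proof.
have h : 1 <= 2 :> R by lra.
by have := ler_powR h hs; rewrite powRr0.
Qed.
Let N2nu : N%:R ^+ 2 * nu <= kap0.
Proof. by rewrite ler_peMr // mulr_ge0 // ltW. Qed.
Let N2nu_ge0 : 0 <= N%:R ^+ 2 * nu.
Proof. by rewrite mulr_ge0 // ltW. Qed.
Let kap0_ge0 : 0 <= kap0.
Proof. exact: le_trans N2nu. Qed.

Local Notation inQ l := ((l != 0) && (l != k)).

Let Vc l m : (V l m)^*%C = V m l. Proof. by rewrite -V_herm. Qed.

Let Dk : D k = D 0. Proof. by rewrite -{1}(subr0 k) D_refl. Qed.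

Let W0 x : 0 < W x. Proof. exact: weight_gt0. Qed.

Section FixedLambda.
Variable lam : R.
Hypothesis lam_near : `|lam - D 0| <= 2 / N%:R ^+ 2.

(** Both brackets are at least 1 on [inQ], so replacing [D 0] by [lam] costs at most half of the
    gap. *)
Lemma cluster_gap (l : 'I_n.+2) : inQ l ->
  2 * (bracket N l)%:R * (bracket N (k - l)%R)%:R / N%:R ^+ 2 <= `|lam - D l|.
Proof.
move=> /andP[l0 lk].
have b1 : 1 <= (bracket N l)%:R :> R by rewrite ler1n bracket_gt0.
have b2 : 1 <= (bracket N (k - l)%R)%:R :> R.
  by rewrite ler1n bracket_gt0 // subr_eq0 eq_sym.
have b12 : 1 <= (bracket N l)%:R * (bracket N (k - l)%R)%:R :> R.
  by rewrite -[leLHS]mulr1 ler_pM.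
have h2 : `|D 0 - D l| <= `|lam - D 0| + `|lam - D l|.
  by rewrite -(distrC (D 0)); apply: le_trans (ler_normD _ _); rewrite addrA subrK.
have i0 : 0 < (N%:R ^+ 2)^-1 :> R by rewrite invr_gt0.
have h3 := ler_wpM2r (ltW i0) b12.
have h4 := D_gap l; rewrite mul1r in h3; have h5 := lam_near.
move: h2 h3 h4 h5; set i := (N%:R ^+ 2)^-1; set b := (bracket N l)%:R.
by set b' := (bracket N _)%:R => h2 h3 h4 h5; lra.
Qed.

(* Evaluating at k - l turns the estimate, whose natural variable is k - l,
   into one for convolutions independent of k. *)
Let wnorm (y : 'I_n.+2 -> R[i]) : R := l2norm (fun l => W (k - l) * normc (y l)).

(** Distributing [W (k - l)] over [W (l - m)] and [W (k - m)], Cauchy-Schwarz bounds the convolution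
    with [v] by a constant in [l]. Division by the gap then produces [ib l] and [ib (k - l)]; both
    are kept, since [schur_beta_error] uses one in each factor of a convolution. *)
Lemma resolvent_pointwise (g : 'I_n.+2 -> R) (y : 'I_n.+2 -> R[i]) :
  (forall l, 0 <= g l) -> y 0 = 0 -> y k = 0 ->
  (forall l, inQ l ->
     normc ((lam - D l)%:C * y l) <= g (k - l) + \sum_m v (l - m) * normc (y m)) ->
  forall l, W (k - l) * normc (y l) <=
    N%:R ^+ 2 / 2 * (ib l * ib (k - l) *
      (W (k - l) * g (k - l) + powR 2 s * nu * wnorm y)).
Proof.
move=> g0 y0 yk hy l.
have rhs0 : 0 <= W (k - l) * g (k - l) + powR 2 s * nu * wnorm y.
  by rewrite addr_ge0 ?mulr_ge0 ?l2norm_ge0 ?powR_ge0 // ltW.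
have [lQ|] := boolP (inQ l); last first.
  rewrite negb_and !negbK => /orP[] /eqP lE.
    rewrite {1 2}lE y0 normc0 mulr0.
    by rewrite mulr_ge0 ?N22_ge0 // mulr_ge0 // mulr_ge0 // inv_bracket_ge0.
  rewrite {1 2}lE yk normc0 mulr0.
  by rewrite mulr_ge0 ?N22_ge0 // mulr_ge0 // mulr_ge0 // inv_bracket_ge0.
have /andP[l0 lk] := lQ.
have b1 : 0 < (bracket N l)%:R :> R by rewrite ltr0n bracket_gt0.
have b2 : 0 < (bracket N (k - l)%R)%:R :> R.
  by rewrite ltr0n bracket_gt0 // subr_eq0 eq_sym.
have conv : W (k - l) * \sum_m v (l - m) * normc (y m) <= powR 2 s * nu * wnorm y.
  rewrite mulr_sumr -mulrA.
  apply: (@le_trans _ _ (\sum_m powR 2 s *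
     ((W (l - m) * v (l - m)) * (W (k - m) * normc (y m))))).
    apply: ler_sum => m _.
    have h : W (k - l) <= powR 2 s * W (k - m) * W (l - m).
      apply: le_trans (weight_sub hs hsigma _ (k - m)) _.
      by rewrite (_ : k - l - (k - m) = - (l - m)) ?weightN //; ring.
    apply: le_trans (ler_wpM2r _ h) _; last by rewrite le_eqVlt; apply/orP; left; apply/eqP; ring.
    by rewrite mulr_ge0 ?normc_ge0.
  rewrite -mulr_sumr ler_wpM2l ?powR_ge0 //.
  apply: le_trans (sum_mul_le_l2norm _ _) _.
  by rewrite (l2norm_reflect (fun l => W l * v l)) // -/nu.
have := le_trans (ler_wpM2l (ltW (W0 (k - l))) (hy l lQ)) (lexx _).
rewrite normcM normc_real mulrDr => h.
have {}h := le_trans h (lerD (lexx _) conv).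
have h2 : 2 / N%:R ^+ 2 * ((bracket N l)%:R * (bracket N (k - l)%R)%:R) *
   (W (k - l) * normc (y l)) <= W (k - l) * g (k - l) + powR 2 s * nu * wnorm y.
  apply: le_trans h; rewrite [leRHS]mulrCA ler_wpM2r ?mulr_ge0 ?normc_ge0 ?(ltW (W0 _)) //.
  by apply: le_trans (cluster_gap lQ); rewrite le_eqVlt; apply/orP; left; apply/eqP; ring.
have c_gt0 : 0 < 2 / N%:R ^+ 2 * ((bracket N l)%:R * (bracket N (k - l)%R)%:R) :> R.
  by rewrite !mulr_gt0 ?invr_gt0.
rewrite -(ler_pdivlMl _ _ c_gt0) in h2.
apply: le_trans h2 _; rewrite /inv_bracket !invfM invrK le_eqVlt.
by apply/orP; left; apply/eqP; ring.
Qed.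

(** The factor [ib (k - l)], of norm at most 2, makes the constant left by the convolution square
    summable. The result is [kap0 * wnorm y], which [small] absorbs on the left. *)
Lemma resolvent_wnorm (g : 'I_n.+2 -> R) (y : 'I_n.+2 -> R[i]) :
  (forall l, 0 <= g l) -> y 0 = 0 -> y k = 0 ->
  (forall l, inQ l ->
     normc ((lam - D l)%:C * y l) <= g (k - l) + \sum_m v (l - m) * normc (y m)) ->
  wnorm y <= N%:R ^+ 2 * l2norm (fun l => W l * g l).
Proof.
move=> g0 y0 yk hy.
have Y0 : 0 <= wnorm y by exact: l2norm_ge0.
have c0 : 0 <= powR 2 s * nu * wnorm y by rewrite !mulr_ge0 ?powR_ge0.
have h : wnorm y <= N%:R ^+ 2 / 2 *
    (l2norm (fun l => W l * g l) + powR 2 s * nu * wnorm y * 2).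
  apply: (@le_trans _ _ (l2norm (fun l => N%:R ^+ 2 / 2 * (W (k - l) * g (k - l) +
       powR 2 s * nu * wnorm y * ib (k - l))))).
    apply: l2norm_le => l; rewrite ger0_norm ?mulr_ge0 ?normc_ge0 ?(ltW (W0 _)) //.
    apply: le_trans (resolvent_pointwise g0 y0 yk hy l) _.
    apply: ler_wpM2l; first exact: N22_ge0.
    rewrite mulrDr; apply: lerD.
      rewrite ler_piMl ?mulr_ge0 ?(ltW (W0 _)) //.
      by rewrite mulr_ile1 ?inv_bracket_ge0 ?inv_bracket_le1.
    rewrite [leRHS]mulrC ler_wpM2r // ler_piMl ?inv_bracket_ge0 //.
    exact: inv_bracket_le1.
  rewrite l2normZ ?N22_ge0 //; apply: ler_wpM2l; first exact: N22_ge0.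
  apply: le_trans (l2normD _ _) _; apply: lerD.
    by rewrite (l2norm_reflect (fun l => W l * g l)).
  rewrite l2normZ // ler_wpM2l // (l2norm_reflect ib).
  exact: l2norm_inv_bracket.
have e : N%:R ^+ 2 / 2 * (powR 2 s * nu * wnorm y * 2) = kap0 * wnorm y.
  by rewrite /kap0; field.
move: h; rewrite mulrDr e mulrAC.
have := ler_wpM2r Y0 small.
set a := kap0 * _; set b := N%:R ^+ 2 * _.
have b0 : 0 <= b by rewrite mulr_ge0 ?l2norm_ge0 // ltW.
by move=> h1 h2; lra.
Qed.

(* The rows in Q of lam - D - V, completed by the identity on {0, k}. *)
Definition schur_row (l m : 'I_n.+2) : R[i] :=
  if inQ l then (if l == m then (lam - D l)%:C else 0) - V l m
  else (l == m)%:R.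

Lemma schur_row_sum x l : \sum_m schur_row l m * x m =
  if inQ l then (lam - D l)%:C * x l - \sum_m V l m * x m else x l.
Proof.
rewrite /schur_row; case: ifP => _.
  under eq_bigr => m _ do rewrite mulrBl.
  rewrite sumrB (bigD1 l) //= eqxx [X in _ + X - _]big1 ?addr0 // => m ml.
  by rewrite eq_sym (negbTE ml) mul0r.
rewrite (bigD1 l) //= eqxx mul1r [X in _ + X]big1 ?addr0 // => m ml.
by rewrite eq_sym (negbTE ml) mul0r.
Qed.

(** This is [resolvent_wnorm] with zero source. In finite dimension it gives the invertibility
    stated in [schur_unit]. *)
Lemma schur_inj x : (forall l, \sum_m schur_row l m * x m = 0) ->
  forall l, x l = 0.
Proof.
move=> hx.
have x0 : x 0 = 0 by have := hx 0; rewrite schur_row_sum eqxx.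
have xk : x k = 0 by have := hx k; rewrite schur_row_sum eqxx andbF.
have nx : wnorm x <= 0.
  have := @resolvent_wnorm (fun=> 0) x (fun=> lexx 0) x0 xk.
  rewrite (_ : l2norm _ = 0) ?mulr0; last first.
    by rewrite /l2norm big1 ?sqrtr0 // => l _; rewrite mulr0 expr0n.
  apply => l lQ; have := hx l; rewrite schur_row_sum lQ => /eqP.
  rewrite subr_eq0 => /eqP ->; rewrite add0r.
  apply: le_trans (normc_sum _) _; apply: ler_sum => m _.
  by rewrite normcM ler_wpM2r ?normc_ge0.
move=> l; apply: eq0_normc; apply/eqP; rewrite eq_le normc_ge0 andbT.
rewrite -(pmulr_rle0 _ (W0 (k - l))).
apply: le_trans nx; apply: le_trans (le_l2norm _ l).
by rewrite ger0_norm // mulr_ge0 ?normc_ge0 // ltW.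
Qed.

Lemma schur_unit : (\matrix_(m, l) schur_row l m) \in unitmx.
Proof.
rewrite -row_free_unit; apply: inj_row_free => u hu.
apply/rowP => j; rewrite mxE; apply: (schur_inj (x := fun m => u ord0 m)) => l.
have := congr1 (fun A : 'rV_ _ => A ord0 l) hu; rewrite !mxE => {}hu.
by apply: etrans hu; apply: eq_bigr => m _; rewrite mxE mulrC.
Qed.

(** The vector with value 0 at mode 0 and 1 at mode [k] that satisfies the eigenvalue equation on
    all rows of [inQ]. The matrix is transposed because vectors are rows, and [locked] keeps the
    inverse folded. *)
Definition schur_sol (l : 'I_n.+2) : R[i] :=
  locked (delta_mx ord0 k *m invmx (\matrix_(m, l) schur_row l m) : 'rV_(n.+2)) ord0 l.

Lemma schur_solP l : \sum_m schur_row l m * schur_sol m = (l == k)%:R.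
Proof.
have := congr1 (fun A : 'rV_ _ => A ord0 l)
  (mulmxKV schur_unit (delta_mx ord0 k : 'rV_(n.+2))).
rewrite !mxE /= => h.
apply: etrans (etrans h _); last by [].
by apply: eq_bigr => m _; rewrite mxE mulrC /schur_sol -lock.
Qed.

Lemma schur_sol0 : schur_sol 0 = 0.
Proof. by have := schur_solP 0; rewrite schur_row_sum eqxx eq_sym (negbTE k0). Qed.

Lemma schur_solk : schur_sol k = 1.
Proof. by have := schur_solP k; rewrite schur_row_sum eqxx andbF. Qed.

Lemma schur_solQ l : inQ l ->
  (lam - D l)%:C * schur_sol l = \sum_m V l m * schur_sol m.
Proof.
move=> lQ; apply/eqP; rewrite -subr_eq0; apply/eqP.
have := schur_solP l; rewrite schur_row_sum lQ.
by case/andP: lQ => _ /negbTE ->.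
Qed.

Definition schur_tail (l : 'I_n.+2) : R[i] := if l == k then 0 else schur_sol l.

Lemma schur_tail0 : schur_tail 0 = 0.
Proof. by rewrite /schur_tail schur_sol0; case: ifP. Qed.

Lemma schur_tailk : schur_tail k = 0.
Proof. by rewrite /schur_tail eqxx. Qed.

Lemma schur_sum_split (F : 'I_n.+2 -> R[i]) :
  \sum_m F m * schur_sol m = F k + \sum_m F m * schur_tail m.
Proof.
rewrite (bigD1 k) //= schur_solk mulr1; congr (_ + _).
rewrite [RHS](bigD1 k) //= schur_tailk mulr0 add0r.
by apply: eq_bigr => m /negbTE mk; rewrite /schur_tail mk.
Qed.

Lemma schur_tail_bound l : inQ l ->
  normc ((lam - D l)%:C * schur_tail l) <=
  v (k - l) + \sum_m v (l - m) * normc (schur_tail m).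
Proof.
move=> lQ; rewrite {1}/schur_tail; case/andP: (lQ) => _ /negbTE ->.
rewrite schur_solQ // schur_sum_split.
apply: le_trans (normc_add _ _) _; apply: lerD.
  by rewrite -vN opprB V_bound.
apply: le_trans (normc_sum _) _; apply: ler_sum => m _.
by rewrite normcM ler_wpM2r ?normc_ge0.
Qed.

Lemma wnorm_schur_tail : wnorm schur_tail <= N%:R ^+ 2 * nu.
Proof.
exact: (resolvent_wnorm v_ge0 schur_tail0 schur_tailk schur_tail_bound).
Qed.

Lemma l2norm_schur_tail : l2norm (fun l => normc (schur_tail l)) <= N%:R ^+ 2 * nu.
Proof.
apply: le_trans wnorm_schur_tail; apply: l2norm_le => l.
by rewrite ger0_norm ?normc_ge0 // ler_peMl ?normc_ge0 // weight_ge1.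
Qed.

Definition schur_A : R[i] := \sum_m V k m * schur_sol m.
Definition schur_beta : R[i] := \sum_m V 0 m * schur_sol m.

(** The mode [k] enters only as the argument [x]. Although every [k] has its own operator, the
    errors for all [k] thus form a single convolution, to which Young's inequality applies. *)
Definition feshbach_error (x : 'I_n.+2) : R :=
  powR 2 s * (N%:R ^+ 2 / 2) *
  \sum_l (W l * v l * ib l) * (ib (x - l) * (W (x - l) * v (x - l) + kap0 * nu)).

(** The weight [W k] is distributed over [W l] and [W (k - l)], and each factor of the convolution
    receives one of the two inverse brackets of [resolvent_pointwise]. *)
Lemma schur_beta_error : W k * normc (schur_beta - V 0 k) <= feshbach_error k.
Proof.
rewrite /schur_beta schur_sum_split (addrC (V 0 k)) addrK.
apply: (@le_trans _ _ (\sum_m W k * (v m * normc (schur_tail m)))).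
  rewrite -mulr_sumr ler_wpM2l ?(ltW (W0 _)) //.
  apply: le_trans (normc_sum _) _; apply: ler_sum => m _.
  by rewrite normcM ler_wpM2r ?normc_ge0 // -vN -[- m]sub0r.
rewrite /feshbach_error mulr_sumr; apply: ler_sum => l _.
have h := weight_sub hs hsigma k l.
have h1 := resolvent_pointwise v_ge0 schur_tail0 schur_tailk schur_tail_bound l.
apply: (@le_trans _ _ (powR 2 s * (W l * v l) * (W (k - l) * normc (schur_tail l)))).
  apply: le_trans (ler_wpM2r _ h) _; first by rewrite mulr_ge0 ?normc_ge0.
  by rewrite le_eqVlt; apply/orP; left; apply/eqP; ring.
have p0 : 0 <= powR 2 s * (W l * v l) by rewrite !mulr_ge0 ?powR_ge0 // ltW.
apply: le_trans (ler_wpM2l p0 h1) _.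
have q0 : 0 <= powR 2 s * (W l * v l) * (N%:R ^+ 2 / 2 * (ib l * ib (k - l))).
  by rewrite mulr_ge0 // mulr_ge0 ?N22_ge0 // mulr_ge0 ?inv_bracket_ge0.
have h2 : powR 2 s * nu * wnorm schur_tail <= kap0 * nu.
  apply: le_trans (ler_wpM2l _ wnorm_schur_tail) _; first by rewrite mulr_ge0 ?powR_ge0.
  by rewrite /kap0 le_eqVlt; apply/orP; left; apply/eqP; ring.
have h3 := ler_wpM2l q0 (lerD (lexx (W (k - l) * v (k - l))) h2).
rewrite -[leLHS]mulrA in h3; rewrite -[_ * ib (k - l) * _ in leLHS]mulrA.
move: h3; rewrite -!mulrA => h3.
by apply: le_trans h3 _; rewrite le_eqVlt; apply/orP; left; apply/eqP; ring.
Qed.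

Let v_le l : v l <= nu.
Proof.
apply: le_trans (le_l2norm _ l).
by rewrite ger0_norm ?mulr_ge0 ?(ltW (W0 _)) // ler_peMl // weight_ge1.
Qed.

Let l2v : l2norm v <= nu.
Proof.
apply: l2norm_le => l.
by rewrite ger0_norm ?mulr_ge0 ?(ltW (W0 _)) // ler_peMl // weight_ge1.
Qed.

Lemma tail_sum_small (w : 'I_n.+2 -> R[i]) (a : 'I_n.+2) :
  (forall m, normc (w m) <= v (a - m)) ->
  normc (\sum_m w m * schur_tail m) <= nu / 8.
Proof.
move=> hw; apply: le_trans (normc_sum _) _.
apply: (@le_trans _ _ (\sum_m v (a - m) * normc (schur_tail m))).
  by apply: ler_sum => m _; rewrite normcM ler_wpM2r ?normc_ge0.
apply: le_trans (sum_mul_le_l2norm _ _) _; rewrite (l2norm_reflect v).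
apply: ler_pM; rewrite ?l2norm_ge0 //.
by apply: le_trans l2norm_schur_tail (le_trans N2nu small).
Qed.

Lemma schur_A_small : normc schur_A <= nu + nu / 8.
Proof.
rewrite /schur_A schur_sum_split; apply: le_trans (normc_add _ _) _.
apply: lerD; last exact: tail_sum_small (V_bound k).
by apply: le_trans (V_bound k k) (v_le _).
Qed.

Lemma schur_beta_small : normc schur_beta <= nu + nu / 8.
Proof.
rewrite /schur_beta schur_sum_split; apply: le_trans (normc_add _ _) _.
apply: lerD; last exact: tail_sum_small (V_bound 0).
by apply: le_trans (V_bound 0 k) (v_le _).
Qed.

Lemma l2norm_schur_sol : l2norm (fun l => normc (schur_sol l)) <= 2.
Proof.
apply: (@le_trans _ _ (l2norm (fun l => (l == k)%:R + normc (schur_tail l)))).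
  apply: l2norm_le => l; rewrite ger0_norm ?normc_ge0 // /schur_tail.
  case: eqP => [->|_]; last by rewrite add0r.
  by rewrite schur_solk normc1 lerDl normc_ge0.
apply: le_trans (l2normD _ _) _.
rewrite (_ : 2 = 1 + 1); last by ring.
apply: lerD; last first.
  apply: le_trans l2norm_schur_tail (le_trans N2nu (le_trans small _)); lra.
rewrite /l2norm (bigD1 k) //= eqxx expr1n big1 ?addr0 ?sqrtr1 // => l /negbTE ->.
by rewrite expr0n.
Qed.

End FixedLambda.

Definition resolvent_op (lam : R) (x : 'I_n.+2 -> R[i]) (l : 'I_n.+2) : R[i] :=
  (lam - D l)%:C * x l - \sum_m V l m * x m.

Lemma resolvent_op_shift lam mu x l :
  resolvent_op lam x l = resolvent_op mu x l + (lam - mu)%:C * x l.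
Proof. by rewrite /resolvent_op !rmorphB /=; ring. Qed.

Lemma resolvent_op_herm lam x y :
  \sum_l (x l)^*%C * resolvent_op lam y l =
  (\sum_l (y l)^*%C * resolvent_op lam x l)^*%C.
Proof.
have E l : ((y l)^*%C * resolvent_op lam x l)^*%C =
    y l * ((lam - D l)%:C * (x l)^*%C) - \sum_m y l * (V m l * (x m)^*%C).
  rewrite /resolvent_op conjcM conjcK -mulr_sumr -mulrBr; congr (_ * _).
  rewrite conjcB conjc_sum conjcM conjc_real; congr (_ - _).
  by apply: eq_bigr => m _; rewrite conjcM Vc.
rewrite conjc_sum; under [RHS]eq_bigr => l _ do rewrite E.
rewrite /resolvent_op.
under [LHS]eq_bigr => l _ do rewrite mulrBr mulr_sumr.
rewrite !sumrB; congr (_ - _); first by apply: eq_bigr => l _; ring.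
rewrite exchange_big /=; apply: eq_bigr => l _; apply: eq_bigr => m _.
by ring.
Qed.

(** The two symmetries of [V] combine into [V (k - l) (k - m) = V m l], so the form twisted by the
    reflection is symmetric without conjugation. *)
Lemma resolvent_op_refl lam x y :
  \sum_l x (k - l) * resolvent_op lam y l =
  \sum_l y (k - l) * resolvent_op lam x l.
Proof.
rewrite [RHS](reindex_inj (inv_inj (subKr k))) /=.
under [RHS]eq_bigr => l _ do
  rewrite subKr /resolvent_op D_refl (reindex_inj (inv_inj (subKr k))) mulrBr mulr_sumr /=.
under [LHS]eq_bigr => l _ do rewrite mulrBr mulr_sumr.
rewrite !sumrB; congr (_ - _); first by apply: eq_bigr => l _; ring.
rewrite exchange_big /=; apply: eq_bigr => l _; apply: eq_bigr => m _.
by rewrite V_refl Vc; ring.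
Qed.

Lemma resolvent_op_sol lam (lam_near : `|lam - D 0| <= 2 / N%:R ^+ 2)
    (c : 'I_n.+2 -> R[i]) :
  \sum_l c l * resolvent_op lam (schur_sol lam) l =
  c k * ((lam - D 0)%:C - schur_A lam) - c 0 * schur_beta lam.
Proof.
rewrite (bigD1 k) //= (bigD1 0) 1?eq_sym //= big1 => [|l /andP[lk l0]].
  rewrite /resolvent_op schur_solk // schur_sol0 // Dk -/(schur_A lam) -/(schur_beta lam).
  by ring.
by rewrite /resolvent_op schur_solQ ?l0 // subrr mulr0.
Qed.

(** A resolvent identity: the Hermitian form of [lam - D - V] between the solutions at [lam] and
    [mu] is evaluated from either side. At [lam = mu] it shows that [schur_A] is real; in general it
    makes the Lipschitz constant a product of two tails, hence small. *)
Lemma schur_A_diff lam mu : `|lam - D 0| <= 2 / N%:R ^+ 2 ->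
  `|mu - D 0| <= 2 / N%:R ^+ 2 ->
  (schur_A mu)^*%C - schur_A lam =
  (lam - mu)%:C * \sum_l schur_tail lam l * (schur_tail mu l)^*%C.
Proof.
move=> hl hm.
have := resolvent_op_herm lam (schur_sol mu) (schur_sol lam).
rewrite [LHS](resolvent_op_sol hl (fun l => (schur_sol mu l)^*%C)).
rewrite schur_solk // schur_sol0 // conjc1 conjc0.
under eq_bigr => l _ do rewrite (resolvent_op_shift lam mu) mulrDr.
rewrite big_split /= (resolvent_op_sol hm (fun l => (schur_sol lam l)^*%C)).
rewrite schur_solk // schur_sol0 // conjc1 conjc0.
under [\sum_l _]eq_bigr => l _ do rewrite mulrCA.
rewrite -mulr_sumr schur_sum_split // schur_solk // conjc1.
have -> : forall S : R[i], (1 * ((mu - D 0)%:C - schur_A mu) - 0 * schur_beta mu +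
    (lam - mu)%:C * (1 + S))^*%C =
    (mu - D 0)%:C - (schur_A mu)^*%C + (lam - mu)%:C * (1 + S^*%C).
  by move=> S; rewrite mul1r mul0r subr0 conjcD conjcB conjcM conjcD conjc1 !conjc_real.
have -> : (\sum_l (schur_sol lam l)^*%C * schur_tail mu l)^*%C =
  \sum_l schur_tail lam l * (schur_tail mu l)^*%C.
  rewrite conjc_sum; apply: eq_bigr => l _; rewrite conjcM conjcK /schur_tail.
  by case: (l == k); rewrite ?conjc0 ?mulr0.
set S := \sum_l _; rewrite mul1r mul0r subr0 !real_complexB /= => h.
apply/eqP; rewrite -subr_eq0; apply/eqP.
by move/eqP: h; rewrite -subr_eq0 => /eqP h; rewrite -[RHS]h; ring.
Qed.

Lemma schur_A_real lam : `|lam - D 0| <= 2 / N%:R ^+ 2 ->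
  schur_A lam = (complex.Re (schur_A lam))%:C.
Proof.
move=> hl; have /eqP := schur_A_diff hl hl.
rewrite subrr mul0r subr_eq0; case: (schur_A lam) => a b /eqP [] h.
by congr Complex; lra.
Qed.

Lemma schur_A_lip lam mu : `|lam - D 0| <= 2 / N%:R ^+ 2 ->
  `|mu - D 0| <= 2 / N%:R ^+ 2 ->
  `|complex.Re (schur_A mu) - complex.Re (schur_A lam)| <= kap0 * `|lam - mu|.
Proof.
move=> hl hm; rewrite -normc_real.
rewrite [X in normc X](_ : _ = schur_A mu - schur_A lam); last first.
  rewrite real_complexB; congr (_ - _); symmetry; exact: schur_A_real.
have -> : schur_A mu = (schur_A mu)^*%C by rewrite (schur_A_real hm) conjc_real.
rewrite schur_A_diff // normcM normc_real mulrC ler_wpM2r //.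
apply: le_trans (normc_sum _) _.
apply: (@le_trans _ _ (\sum_l normc (schur_tail lam l) * normc (schur_tail mu l))).
  by apply: ler_sum => l _; rewrite normcM normc_conj.
apply: le_trans (sum_mul_le_l2norm _ _) _; rewrite -[leRHS]mulr1.
apply: ler_pM; rewrite ?l2norm_ge0 //.
  exact: le_trans (l2norm_schur_tail hl) N2nu.
apply: le_trans (l2norm_schur_tail hm) (le_trans N2nu (le_trans small _)); lra.
Qed.

(** The same evaluation with the reflected form, which picks out row 0 instead of row [k]. Full
    solutions appear in place of tails, whence 2 * 2, which is not small but suffices for
    continuity. *)
Lemma schur_beta_lip lam mu : `|lam - D 0| <= 2 / N%:R ^+ 2 ->
  `|mu - D 0| <= 2 / N%:R ^+ 2 ->
  normc (schur_beta mu - schur_beta lam) <= 4 * `|lam - mu|.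
Proof.
move=> hl hm.
have := resolvent_op_refl lam (schur_sol mu) (schur_sol lam).
rewrite [LHS](resolvent_op_sol hl (fun l => schur_sol mu (k - l))) subrr subr0 schur_solk // schur_sol0 //.
under [in RHS]eq_bigr => l _ do rewrite (resolvent_op_shift lam mu) mulrDr.
rewrite big_split /= (resolvent_op_sol hm (fun l => schur_sol lam (k - l))) subrr subr0 schur_solk // schur_sol0 //.
under [\sum_l _]eq_bigr => l _ do rewrite mulrCA.
rewrite -mulr_sumr; set S := \sum_l _ => h.
have aux (x y b b' z : R[i]) :
    0 * x - 1 * b' = 0 * y - 1 * b + z -> b - b' = z.
  by rewrite !mul0r !mul1r !sub0r => e; rewrite addrC e addrAC addNr add0r.
rewrite (aux _ _ _ _ _ h).
rewrite normcM normc_real mulrC ler_wpM2r //.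
apply: le_trans (normc_sum _) _.
apply: (@le_trans _ _ (\sum_l normc (schur_sol lam (k - l)) * normc (schur_sol mu l))).
  by apply: ler_sum => l _; rewrite normcM.
apply: le_trans (sum_mul_le_l2norm _ _) _.
rewrite (l2norm_reflect (fun l => normc (schur_sol lam l))).
have -> : 4 = 2 * 2 :> R by ring.
by apply: ler_pM; rewrite ?l2norm_ge0 ?l2norm_schur_sol.
Qed.

Lemma resolvent_op_lin lam a b x y l :
  resolvent_op lam (fun m => a * x m + b * y m) l =
  a * resolvent_op lam x l + b * resolvent_op lam y l.
Proof.
rewrite /resolvent_op; under eq_bigr => m _ do rewrite mulrDr !(mulrCA (V l m)).
rewrite big_split /= -!mulr_sumr.
move: (\sum_m V l m * x m) (\sum_m V l m * y m) => X Y; ring.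
Qed.

(** Hence the conjugate reflection of [schur_sol] solves the rows of [inQ] with value 1 at mode 0
    and 0 at mode [k]. The two diagonal entries of the Schur complement therefore coincide, and one
    solution serves both columns. *)
Lemma resolvent_op_conj lam x l :
  resolvent_op lam (fun m => (x (k - m))^*%C) l = (resolvent_op lam x (k - l))^*%C.
Proof.
rewrite /resolvent_op conjcB conjcM conjc_real D_refl conjc_sum; congr (_ - _).
rewrite [RHS](reindex_inj (inv_inj (subKr k))) /=.
by apply: eq_bigr => m _; rewrite V_refl conjcM conjcK.
Qed.

Lemma is_eigenvalueP lam :
  is_eigenvalue lam <-> exists phi : 'I_n.+2 -> R[i], (exists l, phi l != 0) /\
    forall l, resolvent_op lam phi l = 0.
Proof.
split=> -[phi [phi0 h]]; exists phi; split=> // l; have {h} := h l;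
  rewrite /resolvent_op real_complexB mulrBl;
  move: (lam%:C * _) ((D l)%:C * _) (\sum_m _) => T P Q.
  by move=> <-; ring.
by move=> h; apply/esym/eqP; rewrite -subr_eq0; apply/eqP; rewrite -[RHS]h; ring.
Qed.

Lemma resolvent_op_sol0 lam : `|lam - D 0| <= 2 / N%:R ^+ 2 ->
  resolvent_op lam (schur_sol lam) 0 = - schur_beta lam.
Proof. by move=> hl; rewrite /resolvent_op schur_sol0 // mulr0 sub0r. Qed.

Lemma resolvent_op_solk lam : `|lam - D 0| <= 2 / N%:R ^+ 2 ->
  resolvent_op lam (schur_sol lam) k =
  (lam - D 0 - complex.Re (schur_A lam))%:C.
Proof.
move=> hl; rewrite /resolvent_op schur_solk // mulr1 Dk.
by rewrite [in RHS]real_complexB -schur_A_real.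
Qed.

Lemma resolvent_op_solQ lam l : `|lam - D 0| <= 2 / N%:R ^+ 2 -> inQ l ->
  resolvent_op lam (schur_sol lam) l = 0.
Proof. by move=> hl lQ; rewrite /resolvent_op schur_solQ // subrr. Qed.

Let inQ_refl l : inQ l -> inQ (k - l).
Proof.
case/andP=> l0 lk; rewrite subr_eq0 eq_sym lk /=.
by apply: contra_neq l0 => h; rewrite -(subKr k l) h subrr.
Qed.

Let schur_comb lam (x0 xk : R[i]) (l : 'I_n.+2) : R[i] :=
  x0 * (schur_sol lam (k - l))^*%C + xk * schur_sol lam l.

Let schur_comb0 lam x0 xk : `|lam - D 0| <= 2 / N%:R ^+ 2 ->
  schur_comb lam x0 xk 0 = x0.
Proof.
by move=> hl; rewrite /schur_comb subr0 schur_solk // schur_sol0 // conjc1 mulr1 mulr0 addr0.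
Qed.

Let schur_combk lam x0 xk : `|lam - D 0| <= 2 / N%:R ^+ 2 ->
  schur_comb lam x0 xk k = xk.
Proof.
by move=> hl; rewrite /schur_comb subrr schur_solk // schur_sol0 // conjc0 mulr1 mulr0 add0r.
Qed.

Let resolvent_op_comb lam x0 xk l : `|lam - D 0| <= 2 / N%:R ^+ 2 ->
  resolvent_op lam (schur_comb lam x0 xk) l =
  if l == 0 then x0 * (lam - D 0 - complex.Re (schur_A lam))%:C - xk * schur_beta lam
  else if l == k then xk * (lam - D 0 - complex.Re (schur_A lam))%:C
                      - x0 * (schur_beta lam)^*%C
  else 0.
Proof.
move=> hl; rewrite /schur_comb resolvent_op_lin resolvent_op_conj.
case: eqP => [->|/eqP l0].
  by rewrite subr0 resolvent_op_solk // resolvent_op_sol0 // conjc_real mulrN.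
case: eqP => [->|/eqP lk].
  rewrite subrr resolvent_op_solk // resolvent_op_sol0 //.
  by rewrite -sub0r conjcB conjc0 sub0r mulrN addrC.
have lQ : inQ l by rewrite l0.
by rewrite !resolvent_op_solQ ?inQ_refl // conjc0 !mulr0 addr0.
Qed.

(** By [schur_inj] an eigenvector is determined by its values at 0 and [k], which satisfy a 2 x 2
    system with equal diagonal entries. *)
Lemma feshbach_eigenvalue lam : `|lam - D 0| <= 2 / N%:R ^+ 2 ->
  is_eigenvalue lam ->
  `|lam - D 0 - complex.Re (schur_A lam)| = normc (schur_beta lam).
Proof.
move=> hl /is_eigenvalueP [phi [[l0 phil0] hphi]].
have phiE l : phi l = schur_comb lam (phi 0) (phi k) l.
  apply/eqP; rewrite -subr_eq0; apply/eqP; move: l.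
  apply: (schur_inj hl) => l; rewrite schur_row_sum.
  case: ifP => lQ; last first.
    move/negbT: lQ; rewrite negb_and !negbK => /orP[] /eqP ->.
      by rewrite schur_comb0 // subrr.
    by rewrite schur_combk // subrr.
  have := resolvent_op_lin lam 1 (-1) phi (schur_comb lam (phi 0) (phi k)) l.
  rewrite hphi resolvent_op_comb // mulr0 add0r.
  case/andP: lQ => /negbTE -> /negbTE ->; rewrite mulr0 /resolvent_op => h.
  apply: etrans h; congr (_ * _ - _); first by rewrite mul1r mulN1r.
  by apply: eq_bigr => m _; rewrite mul1r mulN1r.
have phiR l : resolvent_op lam (schur_comb lam (phi 0) (phi k)) l = 0.
  rewrite -(hphi l) /resolvent_op -phiE; congr (_ - _).
  by apply: eq_bigr => m _; rewrite -phiE.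
have := phiR 0; rewrite resolvent_op_comb // eqxx => /eqP; rewrite subr_eq0 => /eqP e0.
have := phiR k; rewrite resolvent_op_comb // eqxx (negbTE k0) => /eqP.
rewrite subr_eq0 => /eqP ek.
have := congr1 (@normc R) e0; have := congr1 (@normc R) ek.
rewrite !normcM normc_real normc_conj => {e0 ek}.
have p0 := normc_ge0 (phi 0); have q0 := normc_ge0 (phi k).
(* With [a] and [b] the moduli of the diagonal and off-diagonal entries, the moduli of the two
   equations add up to (|phi 0| + |phi k|) (a - b) = 0; this sum is the factor to cancel. *)
have pq : normc (phi 0) + normc (phi k) != 0.
  apply/eqP => pq; have P0 : normc (phi 0) = 0 by lra.
  have Q0 : normc (phi k) = 0 by lra.
  move: phil0; rewrite phiE /schur_comb (eq0_normc P0) (eq0_normc Q0) !mul0r addr0.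
  by rewrite eqxx.
set a := `|_|; set b := normc (schur_beta _) => h1 h2.
apply: (mulfI pq); rewrite !mulrDl h1 h2; ring.
Qed.

Lemma eigenvalue_feshbach lam : `|lam - D 0| <= 2 / N%:R ^+ 2 ->
  `|lam - D 0 - complex.Re (schur_A lam)| = normc (schur_beta lam) ->
  is_eigenvalue lam.
Proof.
move=> hl hab; apply/is_eigenvalueP.
(* The vector (beta, a) lies in the kernel because a^2 = |beta|^2. It is zero if beta vanishes, but
   then the 2 x 2 system is zero and (1, 0) will do. *)
have [b0|b0] := eqVneq (schur_beta lam) 0.
  exists (schur_comb lam 1 0); split.
    by exists 0; rewrite schur_comb0 // oner_neq0.
  move=> l; rewrite resolvent_op_comb //.
  move: hab; rewrite b0 normc0 => /normr0_eq0 ->; rewrite conjc0 !mulr0 subrr.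
  by case: (l == 0); case: (l == k).
set a : R := lam - D 0 - complex.Re (schur_A lam) in hab *.
exists (schur_comb lam (schur_beta lam) a%:C); split.
  by exists 0; rewrite schur_comb0.
move=> l; rewrite resolvent_op_comb // -/a.
case: eqP => _; first by rewrite mulrC subrr.
case: eqP => _ //.
by rewrite mul_conjc_normc -hab real_normK ?num_real // -real_complexM expr2 subrr.
Qed.

Let beta_close lam : `|lam - D 0| <= 2 / N%:R ^+ 2 ->
  `|normc (schur_beta lam) - normc (V 0 k)| <= feshbach_error k / W k.
Proof.
move=> hl; rewrite ler_pdivlMr // mulrC.
apply: le_trans (schur_beta_error hl); rewrite ler_wpM2l ?(ltW (W0 _)) //.
exact: normc_sub.
Qed.

Let nu_delta : nu + nu / 8 + (nu + nu / 8) <= 2 / N%:R ^+ 2.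
Proof.
rewrite ler_pdivlMr //.
have -> : (nu + nu / 8 + (nu + nu / 8)) * N%:R ^+ 2 = 9 / 4 * (N%:R ^+ 2 * nu).
  by move: nu (N%:R ^+ 2) => x y; field.
have := le_trans N2nu small; move: (_ * _) => x h; lra.
Qed.

Lemma feshbach_reduction : exists A b : R -> R,
  (forall lam, 0 <= b lam) /\
  (forall lam, `|lam - D 0| <= 2 / N%:R ^+ 2 ->
    [/\ is_eigenvalue lam <-> `|lam - D 0 - A lam| = b lam,
        `|A lam| + b lam <= 2 / N%:R ^+ 2,
        `|b lam - normc (V 0 k)| <= feshbach_error k / W k &
        forall mu, `|mu - D 0| <= 2 / N%:R ^+ 2 ->
          `|A lam - A mu| <= kap0 * `|lam - mu| /\
          `|b lam - b mu| <= 4 * `|lam - mu|]).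
Proof.
exists (fun lam => complex.Re (schur_A lam)), (fun lam => normc (schur_beta lam)).
split=> [lam|lam hl]; first exact: normc_ge0.
split.
- by split; [exact: feshbach_eigenvalue | exact: eigenvalue_feshbach].
- apply: le_trans nu_delta; apply: lerD; last exact: schur_beta_small.
  by rewrite -normc_real -schur_A_real // schur_A_small.
- exact: beta_close.
move=> mu hm; rewrite (distrC lam mu); split; first exact: schur_A_lip.
exact: le_trans (normc_sub _ _) (schur_beta_lip hm hl).
Qed.

Lemma cluster_width_upper lam mu :
  `|lam - D 0| <= 2 / N%:R ^+ 2 -> `|mu - D 0| <= 2 / N%:R ^+ 2 ->
  is_eigenvalue lam -> is_eigenvalue mu ->
  (1 - kap0) * `|lam - mu| <= 2 * (normc (V 0 k) + feshbach_error k / W k).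
Proof.
have [A [b [b0 H]]] := feshbach_reduction.
by apply: (@lipschitz_width_upper _ _ A b) => [x /H []|x /H []|x y /H [_ _ _ h] /h []].
Qed.

Lemma cluster_width_lower : exists lam mu : R,
  [/\ `|lam - D 0| <= 2 / N%:R ^+ 2, `|mu - D 0| <= 2 / N%:R ^+ 2,
      is_eigenvalue lam, is_eigenvalue mu &
      2 * (normc (V 0 k) - feshbach_error k / W k) <= (1 + kap0) * `|lam - mu|].
Proof.
have [A [b [b0 H]]] := feshbach_reduction.
have d0 : 0 <= 2 / N%:R ^+ 2 :> R by rewrite divr_ge0 // ltW.
apply: (@lipschitz_width_lower _ _ A b) => //.
- by move=> x /H [].
- by move=> x /H [].
- by move=> x /H [].
- by move=> x y /H [_ _ _ h] /h [].
- by move=> x y /H [_ _ _ h] /h [].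
Qed.

End Feshbach.

Section FeshbachErrorNorm.
Variables (R : realType) (n : nat) (v : 'I_n.+2 -> R) (s sigma : R).
Hypotheses (hs : 0 <= s) (hsigma : 0 <= sigma).
Local Notation nu := (l2norm (fun l => @weight R s sigma n l * v l)).
Local Notation kap := (n.+2%:R ^+ 2 * nu * powR 2 s).

(** Young's inequality with [W l * v l * ib l] in l^1, of norm at most 2 nu by Cauchy-Schwarz, and
    the other factor in l^2, of norm at most nu + 2 kap nu <= 2 nu. *)
Lemma l2norm_feshbach_error : (forall l, 0 <= v l) -> kap <= 8^-1 ->
  l2norm (feshbach_error v s sigma) <= 2 * kap * nu.
Proof.
move=> v0 small; rewrite /feshbach_error.
set W := @weight R s sigma n; set ib := @inv_bracket R n.
have nu0 : 0 <= nu by exact: l2norm_ge0.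
have kap0 : 0 <= kap by rewrite mulr_ge0 ?powR_ge0 // mulr_ge0.
have Wv l : 0 <= W l * v l by rewrite mulr_ge0 // ltW // weight_gt0.
rewrite l2normZ; last by rewrite mulr_ge0 ?powR_ge0 // divr_ge0.
set G := fun l => ib l * (W l * v l + kap * nu).
have G0 l : 0 <= G l by rewrite mulr_ge0 ?inv_bracket_ge0 // addr_ge0 // mulr_ge0.
have Gnu : l2norm G <= nu + 2 * (kap * nu).
  apply: (@le_trans _ _ (l2norm (fun l => W l * v l + kap * nu * ib l))).
    apply: l2norm_le => l; rewrite ger0_norm // /G mulrDr (mulrC (ib l) (kap * nu)).
    by rewrite lerD2r ler_piMl ?inv_bracket_le1.
  apply: le_trans (l2normD _ _) _; rewrite lerD2l l2normZ ?mulr_ge0 //.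
  by rewrite mulrC ler_wpM2r ?mulr_ge0 ?l2norm_inv_bracket.
have F1 : \sum_l W l * v l * ib l <= nu * 2.
  apply: le_trans (sum_mul_le_l2norm _ _) _.
  by rewrite ler_wpM2l ?l2norm_inv_bracket.
have := @young_l1_l2 R 'I_n.+2 (fun l => W l * v l * ib l) G.
move=> /(_ (fun l => mulr_ge0 (Wv l) (inv_bracket_ge0 _ _)) G0) h.
have c0 : 0 <= powR 2 s * (n.+2%:R ^+ 2 / 2) :> R by rewrite mulr_ge0 ?powR_ge0 // divr_ge0.
apply: le_trans (ler_wpM2l c0 h) _.
have S0 : 0 <= \sum_l W l * v l * ib l.
  by apply: sumr_ge0 => l _; rewrite mulr_ge0 ?inv_bracket_ge0.
apply: le_trans (ler_wpM2l c0 (ler_pM S0 (l2norm_ge0 _) F1 Gnu)) _.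
have aux (p q w z : R) : p * (q / 2) * (w * 2 * z) = q * w * p * z by field.
have aux2 (x y : R) : 2 * x * y = x * (2 * y) by ring.
rewrite aux aux2.
rewrite ler_wpM2l //.
have := ler_wpM2r nu0 small; move: (kap * nu) => t; move: nu nu0 => w h1 h2; lra.
Qed.

End FeshbachErrorNorm.

(** * Isospectrality of a Lax flow *)

Section ComplexDerivative.
Variable R : realType.
Implicit Types (f g : R -> R[i]) (t : R).

Definition cderiv f t (df : R[i]) : Prop :=
  is_derive t 1 (fun u => complex.Re (f u)) (complex.Re df) /\
  is_derive t 1 (fun u => complex.Im (f u)) (complex.Im df).

Lemma is_derive_congr (f g : R -> R) t df dg : f =1 g -> df = dg ->
  is_derive t 1 f df -> is_derive t 1 g dg.
Proof. by move=> /funext <- <-. Qed.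

Lemma cderiv_cst (c : R[i]) t : cderiv (fun=> c) t 0.
Proof. by split; exact: is_derive_cst. Qed.

Lemma cderiv_real (f : R -> R) t df :
  is_derive t 1 f df -> cderiv (fun u => (f u)%:C) t df%:C.
Proof. by move=> h; split=> //=; exact: is_derive_cst. Qed.

Lemma cderivD f g t df dg : cderiv f t df -> cderiv g t dg ->
  cderiv (fun u => f u + g u) t (df + dg).
Proof.
move=> [f1 f2] [g1 g2]; split.
  by apply: is_derive_congr (is_deriveD f1 g1) => [u|]; rewrite raddfD.
by apply: is_derive_congr (is_deriveD f2 g2) => [u|]; rewrite raddfD.
Qed.

Lemma cderivM f g t df dg : cderiv f t df -> cderiv g t dg ->
  cderiv (fun u => f u * g u) t (df * g t + f t * dg).
Proof.
move=> [f1 f2] [g1 g2]; split.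
  apply: is_derive_congr (is_deriveB (is_deriveM f1 g1) (is_deriveM f2 g2)) => [u|].
    by rewrite !fctE; case: (f u) => a b; case: (g u).
  rewrite /GRing.scale /=.
  clear f1 f2 g1 g2; by case: (f t) df (g t) dg => a b [c d] [a' b'] [c' d'] /=; ring.
apply: is_derive_congr (is_deriveD (is_deriveM f1 g2) (is_deriveM f2 g1)) => [u|].
  by rewrite !fctE; case: (f u) => a b; case: (g u) => c d /=; ring.
rewrite /GRing.scale /=.
clear f1 f2 g1 g2; by case: (f t) df (g t) dg => a b [c d] [a' b'] [c' d'] /=; ring.
Qed.

Lemma cderiv_sum (I : Type) (r : seq I) (F : I -> R -> R[i]) t dF :
  (forall i, cderiv (F i) t (dF i)) ->
  cderiv (fun u => \sum_(i <- r) F i u) t (\sum_(i <- r) dF i).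
Proof.
move=> h; elim: r => [|i r IH].
  rewrite big_nil; have -> : (fun u => \sum_(i <- [::]) F i u) = fun=> 0.
    by apply/funext => u; rewrite big_nil.
  exact: cderiv_cst.
rewrite big_cons.
have -> : (fun u => \sum_(j <- i :: r) F j u) =
    (fun u => F i u + \sum_(j <- r) F j u).
  by apply/funext => u; rewrite big_cons.
exact: cderivD.
Qed.

Lemma cderiv0_cst f : (forall t, cderiv f t 0) -> forall t u, f t = f u.
Proof.
move=> h t u; apply/eqP; rewrite eq_complex; apply/andP; split; apply/eqP.
  by apply: (@is_derive_0_is_cst _ (fun x => complex.Re (f x))) => x; case: (h x).
by apply: (@is_derive_0_is_cst _ (fun x => complex.Im (f x))) => x; case: (h x).
Qed.

Definition mderiv (n : nat) (A : R -> 'M[R[i]]_n) t (dA : 'M[R[i]]_n) : Prop :=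
  forall i j, cderiv (fun u => A u i j) t (dA i j).

Lemma mderivM (n : nat) (A B : R -> 'M[R[i]]_n) t dA dB :
  mderiv A t dA -> mderiv B t dB ->
  mderiv (fun u => A u *m B u) t (dA *m B t + A t *m dB).
Proof.
move=> hA hB i j.
have -> : (fun u => (A u *m B u) i j) = (fun u => \sum_k A u i k * B u k j).
  by apply/funext => u; rewrite mxE.
rewrite !mxE -big_split /=; apply: cderiv_sum => k.
exact: cderivM.
Qed.

End ComplexDerivative.

Section Isospectral.
Variables (R : realType) (n : nat).
Variables (L B : R -> 'M[R[i]]_n.+1).
Hypothesis L_lax : forall t, mderiv L t (L t *m B t - B t *m L t).
Hypothesis L_herm : forall t i j, L t i j = (L t j i)^*%C.

Lemma mderiv_laxX m t :
  mderiv (fun u => L u ^+ m) t (L t ^+ m *m B t - B t *m L t ^+ m).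
Proof.
elim: m => [|m IH].
  rewrite expr0 mul1mx mulmx1 subrr => i j.
  rewrite [X in cderiv _ _ X](_ : _ = 0); last by rewrite mxE.
  exact: (cderiv_cst ((1 : 'M[R[i]]_n.+1) i j) t).
have -> : L t ^+ m.+1 *m B t - B t *m L t ^+ m.+1 =
   (L t *m B t - B t *m L t) *m L t ^+ m +
   L t *m (L t ^+ m *m B t - B t *m L t ^+ m).
  rewrite exprS -mulmxE mulmxBl mulmxBr !mulmxA.
  by rewrite [RHS]addrC addrA subrK.
have -> : (fun u => L u ^+ m.+1) = (fun u => L u *m L u ^+ m).
  by apply/funext => u; rewrite exprS.
exact: mderivM.
Qed.

(** The powers of [L] satisfy the same Lax equation, and the trace of a commutator vanishes. *)
Lemma mxtrace_lax_cst (P : {poly R[i]}) t u :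
  \tr (horner_mx (L t) P) = \tr (horner_mx (L u) P).
Proof.
have trX m : \tr (L t ^+ m) = \tr (L u ^+ m).
  apply: (cderiv0_cst (f := fun x => \tr (L x ^+ m))) => x.
  have <- : \tr (L x ^+ m *m B x - B x *m L x ^+ m) = 0.
    by rewrite raddfB /= mxtrace_mulC subrr.
  by apply: cderiv_sum => i; exact: mderiv_laxX.
have E x : \tr (horner_mx (L x) P) = \sum_(i < size P) P`_i * \tr (L x ^+ i).
  rewrite -[in LHS](coefK P) poly_def !raddf_sum /=; apply: eq_bigr => i _.
  by rewrite horner_mxZ rmorphXn /= horner_mx_X mxtraceZ.
by rewrite !E; apply: eq_bigr => i _; rewrite trX.
Qed.

Lemma mxtrace_mul_ctr (X : 'M[R[i]]_n.+1) :
  \tr (X *m (map_mx conjc X)^T) = 0 -> X = 0.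
Proof.
move=> h.
have : \sum_i \sum_j (normc (X i j) ^+ 2) = 0 :> R.
  apply: (@complexI R); rewrite real_complex_sum -[RHS]h /mxtrace.
  apply: eq_bigr => i _; rewrite mxE real_complex_sum; apply: eq_bigr => j _.
  by rewrite !mxE mul_conjc_normc.
move/eqP; rewrite psumr_eq0 => [|i _]; last by apply: sumr_ge0 => j _; rewrite sqr_ge0.
move/allP => hX; apply/matrixP => i j; rewrite mxE.
have := hX i (mem_index_enum i) => /=.
rewrite psumr_eq0 => [|l _]; last by rewrite sqr_ge0.
move/allP => /(_ j (mem_index_enum j)) /=.
by rewrite sqrf_eq0 => /eqP /eq0_normc.
Qed.

Lemma horner_mx_herm t (P : {poly R[i]}) :
  horner_mx (L t) (map_poly conjc P) = (map_mx conjc (horner_mx (L t) P))^T.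
Proof.
have hL : (map_mx conjc (L t))^T = L t.
  by apply/matrixP => i j; rewrite !mxE -L_herm.
have hX m : (map_mx conjc (L t ^+ m))^T = L t ^+ m.
  elim: m => [|m IH]; first by rewrite !expr0 map_mx1 trmx1.
  by rewrite exprS map_mxM trmx_mul IH hL mulmxE -exprSr -exprS.
rewrite -[in LHS](coefK P) -[in RHS](coefK P) poly_def !raddf_sum /=.
apply: eq_bigr => i _; rewrite !horner_mxZ.
rewrite map_polyZ /= !rmorphXn /= map_polyX horner_mxZ rmorphXn /= horner_mx_X.
by rewrite map_mxZ linearZ /= hX.
Qed.

(** Let P be the characteristic polynomial of [L u]. The trace of P(L t) times its adjoint is the
    trace of a polynomial in [L t], hence constant in time, and it is zero at [u] by
    Cayley-Hamilton. So P annihilates [L t], whose minimal polynomial divides P. No unitary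
    conjugation between [L t] and [L u] has to be constructed. *)
Lemma lax_eigenvalue t u (a : R[i]) : eigenvalue (L t) a -> eigenvalue (L u) a.
Proof.
pose P := char_poly (L u); pose X := horner_mx (L t) P.
have X0 : X = 0.
  apply: mxtrace_mul_ctr; rewrite -horner_mx_herm mulmxE -rmorphM /=.
  by rewrite (mxtrace_lax_cst _ t u) rmorphM /= Cayley_Hamilton mul0r mxtrace0.
rewrite eigenvalue_root_min eigenvalue_root_char !root_factor_theorem => ha.
exact: dvdp_trans ha (mxminpoly_min X0).
Qed.

End Isospectral.

(** * Fourier representation of the Lax matrix *)

Section Characters.
Variables (R : realType) (n : nat).
Local Notation N := n.+2.
Implicit Types x y : 'I_n.+2.

Lemma cisD (a b : R) : cis (a + b) = cis a * cis b.
Proof.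
rewrite /cis cosD sinD; apply/eqP; rewrite eq_complex /=.
by rewrite eqxx /= addrC.
Qed.

Lemma cis0 : cis 0 = 1 :> R[i].
Proof. by rewrite /cis cos0 sin0. Qed.

Lemma cisN (a : R) : cis (- a) = (cis a)^*%C.
Proof. by rewrite /cis cosN sinN. Qed.

Lemma normc_cis (a : R) : normc (cis a) = 1.
Proof. by rewrite /= cos2Dsin2 sqrtr1. Qed.

Lemma cis_mulC (a : R) : cis a * (cis a)^*%C = 1.
Proof. by rewrite -cisN -cisD subrr cis0. Qed.

Lemma cis_nat2pi (m : nat) : cis (2 * pi * m%:R) = 1 :> R[i].
Proof.
elim: m => [|m IH]; first by rewrite mulr0 cis0.
rewrite -(natr1 m) mulrDr mulr1 cisD IH mul1r /cis.
by rewrite mulrC mulr_natr cos2pi sin2pi.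
Qed.

Definition chi x : R[i] := cis (2 * pi * x%:R / N%:R).

Let N0 : N%:R != 0 :> R. Proof. by rewrite pnatr_eq0. Qed.

Lemma cis_mod (m : nat) :
  cis (2 * pi * m%:R / N%:R) = cis (2 * pi * (m %% N)%:R / N%:R) :> R[i].
Proof.
rewrite {1}(divn_eq m N) natrD natrM mulrDr mulrDl cisD.
by rewrite !mulrA mulfK // cis_nat2pi mul1r.
Qed.

Lemma chiD x y : chi (x + y) = chi x * chi y.
Proof. by rewrite /chi /= -cis_mod natrD mulrDr mulrDl cisD. Qed.

Lemma chi0 : chi 0 = 1.
Proof. by rewrite /chi mulr0 mul0r cis0. Qed.

Lemma chiN x : chi (- x) = (chi x)^*%C.
Proof.
have h : chi x * chi (- x) = 1 by rewrite -chiD subrr chi0.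
have e : chi x * (chi x)^*%C = 1 by exact: cis_mulC.
by rewrite -[RHS]mulr1 -h mulrA (mulrC _^*%C) e mul1r.
Qed.

Lemma normc_chi x : normc (chi x) = 1.
Proof. exact: normc_cis. Qed.

Lemma chi_mul x y :
  cis (2 * pi * x%:R * y%:R / N%:R) = chi (x * y).
Proof. by rewrite /chi /= -cis_mod natrM mulrA. Qed.

Lemma sin_mode_gt0 x : x != 0 -> 0 < sin (x%:R * pi / N%:R : R).
Proof.
move=> x0; apply: sin_gt0_pi; apply/andP; split.
  by rewrite divr_gt0 ?mulr_gt0 ?pi_gt0 ?ltr0n // lt0n; apply: contra_neq x0 => h; apply: val_inj.
by rewrite ltr_pdivrMr ?ltr0n // mulrC ltr_pM2l ?pi_gt0 // ltr_nat.
Qed.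

Lemma chi_neq1 x : x != 0 -> chi x != 1.
Proof.
move=> x0; apply/eqP => /(congr1 (@complex.Re R)) /=.
have -> : 2 * pi * x%:R / N%:R = (x%:R * pi / N%:R) *+ 2 :> R.
  by rewrite -mulr_natl; field.
rewrite cos_mulr2n cos2sin2 => h; have := sin_mode_gt0 x0.
have : sin (x%:R * pi / N%:R : R) ^+ 2 = 0 by lra.
by move/eqP; rewrite sqrf_eq0 => /eqP ->; rewrite ltxx.
Qed.

Lemma sum_chi x : \sum_(j : 'I_n.+2) chi (j * x) = if x == 0 then N%:R else 0.
Proof.
case: eqP => [->|/eqP x0].
  rewrite (eq_bigr (fun=> 1)) => [|j _]; last by rewrite mulr0 chi0.
  by rewrite sumr_const card_ord.
set S := \sum_j _.
have : S * chi x = S.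
  rewrite [in RHS]/S (reindex_inj (addIr 1)) /= mulr_suml; apply: eq_bigr => j _.
  by rewrite mulrDl mul1r chiD.
rewrite -[RHS]mulr1 => /eqP; rewrite -subr_eq0 -mulrBr mulf_eq0 subr_eq0.
by rewrite (negbTE (chi_neq1 x0)) orbF => /eqP.
Qed.

End Characters.

(** * The discrete Fourier transform *)

Section FourierTransform.
Variables (R : realType) (n : nat).
Local Notation N := n.+2.
Implicit Types (x y : 'I_n.+2 -> R) (k l : 'I_n.+2).
Local Notation chi := (@chi R n).

(** The factor is 1/N rather than 1/sqrt N: pointwise products become convolutions without
    constants, and the constant sequence 1 becomes the unit at mode 0. *)
Definition fourier x k : R[i] := (N%:R^-1)%:C * \sum_j (x j)%:C * chi (j * k).

Let N0 : N%:R != 0 :> R. Proof. by rewrite pnatr_eq0. Qed.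

Let NV : (N%:R^-1)%:C * N%:R = 1 :> R[i].
Proof. by rewrite -(rmorph_nat (real_complex R)) -real_complexM mulVf. Qed.

Lemma fourier_conj x k : (fourier x k)^*%C = fourier x (- k).
Proof.
rewrite /fourier conjcM conjc_real conjc_sum; congr (_ * _).
by apply: eq_bigr => j _; rewrite conjcM conjc_real mulrN chiN.
Qed.

Lemma normc_fourierN x k : normc (fourier x (- k)) = normc (fourier x k).
Proof. by rewrite -fourier_conj normc_conj. Qed.

Lemma fourierD x y k :
  fourier (fun j => x j + y j) k = fourier x k + fourier y k.
Proof.
rewrite /fourier -mulrDr -big_split /=; congr (_ * _).
by apply: eq_bigr => j _; rewrite real_complexD mulrDl.
Qed.

Lemma fourierZ a x k : fourier (fun j => a * x j) k = a%:C * fourier x k.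
Proof.
rewrite /fourier mulrCA; congr (_ * _); rewrite mulr_sumr.
by apply: eq_bigr => j _; rewrite real_complexM mulrA.
Qed.

Lemma eq_fourier x y k : x =1 y -> fourier x k = fourier y k.
Proof. by move=> e; congr (_ * _); apply: eq_bigr => j _; rewrite e. Qed.

Lemma fourier_shift x k :
  fourier (fun j => x (j + 1)) k = chi (- k) * fourier x k.
Proof.
rewrite /fourier mulrCA; congr (_ * _); rewrite mulr_sumr.
rewrite [RHS](reindex_inj (addIr 1)) /=; apply: eq_bigr => j _.
by rewrite [RHS]mulrCA -chiD mulrDl mul1r (addrC (- k)) addrK.
Qed.

Lemma fourier1 k : fourier (fun=> 1) k = (k == 0)%:R.
Proof.
rewrite /fourier (eq_bigr (fun j => chi (j * k))) => [|j _]; last by rewrite mul1r.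
by rewrite sum_chi; case: eqP => _; rewrite ?NV ?mulr0.
Qed.

Lemma fourier_inv x j : \sum_k fourier x k * chi (- (j * k)) = (x j)%:C.
Proof.
transitivity ((N%:R^-1)%:C * \sum_i (x i)%:C * \sum_k chi (k * (i - j))).
  rewrite mulr_sumr; under [RHS]eq_bigr => i _ do rewrite !mulr_sumr.
  rewrite [RHS]exchange_big /=; apply: eq_bigr => k _.
  rewrite /fourier mulr_sumr mulr_suml; apply: eq_bigr => i _.
  by rewrite mulrBr chiD (mulrC k i) (mulrC k j) !mulrA.
rewrite (bigD1 j) //= subrr sum_chi eqxx big1 ?addr0 => [|i ij].
  by rewrite mulrCA NV mulr1.
by rewrite sum_chi subr_eq0 (negbTE ij) mulr0.
Qed.

Lemma fourier_inv_shift x j m :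
  \sum_l fourier x (m - l) * chi (j * l) = (x j)%:C * chi (j * m).
Proof.
rewrite -fourier_inv (reindex_inj (inv_inj (subKr m))) mulr_suml /=.
by apply: eq_bigr => l _; rewrite subKr -mulrA -chiD mulrBr [in RHS]addrC.
Qed.

Lemma fourierM x y k :
  fourier (fun j => x j * y j) k = \sum_l fourier x l * fourier y (k - l).
Proof.
rewrite [LHS]/fourier.
transitivity ((N%:R^-1)%:C * \sum_j (y j)%:C * chi (j * k) *
   \sum_l fourier x l * chi (- (j * l))).
  congr (_ * _); apply: eq_bigr => j _.
  by rewrite fourier_inv real_complexM (mulrC (x j)%:C) mulrAC.
rewrite mulr_sumr; under eq_bigr => j _ do rewrite !mulr_sumr.
rewrite exchange_big /=; apply: eq_bigr => l _.
rewrite /fourier [RHS]mulrCA !mulr_sumr; apply: eq_bigr => j _.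
by rewrite mulrBr chiD; move: (fourier x l); rewrite /fourier => f; ring.
Qed.

End FourierTransform.

(** * The Lax pair *)

Lemma eq_succ (n : nat) (i l : 'I_n.+2) : (i == l + 1) = (l == i - 1).
Proof. by rewrite [RHS]eq_sym subr_eq. Qed.

Section LaxMatrix.
Variables (R : realType) (n : nat) (z : R[i]).
Hypothesis hz : z * z^*%C = 1.
Local Notation I := 'I_n.+2.
Implicit Types (p a : I -> R) (i j l m : I).
Local Notation chi := (@chi R n).

Definition lax_diag p : 'M[R[i]]_n.+2 := \matrix_(i, j) ((p i)%:C *+ (i == j)).
(** The two shifts are separate matrices that are added, since for N = 2 the neighbours [i + 1] and
    [i - 1] coincide and both terms belong to the same entry. *)
Definition lax_up a : 'M[R[i]]_n.+2 := \matrix_(i, j) (z * (a i)%:C *+ (j == i + 1)).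
Definition lax_down a : 'M[R[i]]_n.+2 :=
  \matrix_(i, j) (z^*%C * (a j)%:C *+ (i == j + 1)).

(* The phase z makes this N x N matrix the restriction of the infinite periodic
   Jacobi matrix to sequences of Floquet multiplier z^N up to a gauge. *)
Definition lax_matrix p a := lax_diag p + lax_up a + lax_down a.
Definition lax_flow a : 'M[R[i]]_n.+2 := (2^-1)%:C *: (lax_up a - lax_down a).

Lemma sum_mulrb_eq (f : I -> R[i]) c : \sum_l f l *+ (l == c) = f c.
Proof.
under eq_bigr => l _ do rewrite mulrb.
by rewrite -big_mkcond big_pred1_eq.
Qed.

Lemma lax_matrix_herm p a i j : lax_matrix p a i j = (lax_matrix p a j i)^*%C.
Proof.
rewrite !mxE !conjcD -addrA [in RHS]addrAC -addrA; congr (_ + (_ + _)).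
- by rewrite conjcMn conjc_real eq_sym; case: eqP => [->|].
- by rewrite conjcMn conjcM conjc_real conjcK.
- by rewrite conjcMn conjcM conjc_real.
Qed.

Lemma lax_down_up a i j :
  (lax_down a *m lax_up a) i j = (a (i - 1) ^+ 2)%:C *+ (i == j).
Proof.
rewrite mxE (eq_bigr (fun l => (z^*%C * (a l)%:C * (z * (a l)%:C *+ (j == l + 1)))
  *+ (l == i - 1))) => [|l _]; last by rewrite !mxE mulrnAl (eq_succ i).
rewrite sum_mulrb_eq subrK eq_sym mulrnAr; congr (_ *+ _).
by rewrite mulrACA (mulrC z^*%C) hz mul1r expr2 real_complexM.
Qed.

Lemma lax_up_down a i j :
  (lax_up a *m lax_down a) i j = (a i ^+ 2)%:C *+ (i == j).
Proof.
rewrite mxE (eq_bigr (fun l => (z * (a i)%:C * (z^*%C * (a j)%:C *+ (l == j + 1)))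
  *+ (l == i + 1))) => [|l _]; last by rewrite !mxE mulrnAl.
rewrite sum_mulrb_eq (inj_eq (addIr _)) mulrnAr; case: eqP => [->|_] //.
by congr (_ *+ _); rewrite mulrACA hz mul1r expr2 real_complexM.
Qed.

Lemma lax_diag_mul p (A : 'M[R[i]]_n.+2) i j :
  (lax_diag p *m A) i j = (p i)%:C * A i j.
Proof.
rewrite mxE (eq_bigr (fun l => ((p i)%:C * A l j) *+ (l == i))) ?sum_mulrb_eq //.
by move=> l _; rewrite mxE mulrnAl eq_sym.
Qed.

Lemma mul_lax_diag p (A : 'M[R[i]]_n.+2) i j :
  (A *m lax_diag p) i j = A i j * (p j)%:C.
Proof.
rewrite mxE (eq_bigr (fun l => (A i l * (p l)%:C) *+ (l == j))) ?sum_mulrb_eq //.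
by move=> l _; rewrite mxE mulrnAr.
Qed.

(** The up-up and down-down products cancel because the flow is antisymmetric in the two shifts. The
    rest has again the shape of a Lax matrix, whose data are the right-hand sides of the Toda
    equations in Flaschka variables. *)
Lemma lax_commutator p a :
  lax_matrix p a *m lax_flow a - lax_flow a *m lax_matrix p a =
  lax_matrix (fun i => a (i - 1) ^+ 2 - a i ^+ 2)
             (fun i => a i * (p i - p (i + 1)) / 2).
Proof.
rewrite /lax_flow -scalemxAr -scalemxAl -scalerBr.
rewrite [X in _ *: X](_ : _ = (lax_down a *m lax_up a - lax_up a *m lax_down a) *+ 2
  + (lax_diag p *m lax_up a - lax_up a *m lax_diag p)
  + (lax_down a *m lax_diag p - lax_diag p *m lax_down a)); last first.
  rewrite /lax_matrix !(mulmxDl, mulmxDr, mulmxN, mulNmx).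
  move: (lax_diag p *m lax_up a) (lax_up a *m lax_diag p)
    (lax_diag p *m lax_down a) (lax_down a *m lax_diag p)
    (lax_up a *m lax_up a) (lax_down a *m lax_down a)
    (lax_up a *m lax_down a) (lax_down a *m lax_up a) => A1 A2 A3 A4 A5 A6 A7 A8.
  by apply/matrixP => i j; rewrite !mxE; ring.
apply/matrixP => i j.
have half : (2^-1)%:C = 2^-1 :> R[i] by rewrite fmorphV rmorph_nat.
have e1 := lax_down_up a i j; have e2 := lax_up_down a i j.
have e3 := lax_diag_mul p (lax_up a) i j.
have e4 : (lax_diag p *m lax_down a) i j = (p (j + 1))%:C * lax_down a i j.
  by rewrite lax_diag_mul mxE; case: eqP => [->|_] //; rewrite !mulr0n !mulr0.
have e5 : (lax_up a *m lax_diag p) i j = lax_up a i j * (p (i + 1))%:C.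
  by rewrite mul_lax_diag mxE; case: eqP => [->|_] //; rewrite !mulr0n !mul0r.
have e6 := mul_lax_diag p (lax_down a) i j.
move: e1 e2 e3 e4 e5 e6.
move: (lax_diag p *m lax_up a) (lax_up a *m lax_diag p)
    (lax_diag p *m lax_down a) (lax_down a *m lax_diag p)
    (lax_up a *m lax_down a) (lax_down a *m lax_up a) => A1 A2 A3 A4 A7 A8.
move=> e1 e2 e3 e4 e5 e6; rewrite !mxE e1 e2 e3 e4 e5 e6 !mxE.
rewrite !(real_complexM, real_complexB) half.
have two0 : 2 != 0 :> R[i] by rewrite pnatr_eq0.
rewrite !mulrb; case: (i == j); case: (j == i + 1); case: (i == j + 1); by field.
Qed.

Lemma mderiv_lax (p a : R -> I -> R) (t : R) :
  (forall i, is_derive t 1 (fun u => p u i) (a t (i - 1) ^+ 2 - a t i ^+ 2)) ->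
  (forall i, is_derive t 1 (fun u => a u i)
     (a t i * (p t i - p t (i + 1)) / 2)) ->
  mderiv (fun u => lax_matrix (p u) (a u)) t
    (lax_matrix (p t) (a t) *m lax_flow (a t) -
     lax_flow (a t) *m lax_matrix (p t) (a t)).
Proof.
move=> hp ha i j; rewrite lax_commutator.
have hn f df (b : bool) : cderiv f t df -> cderiv (fun u => f u *+ b) t (df *+ b).
  by case: b => // _; exact: cderiv_cst.
have hcM f df (c : R[i]) : cderiv f t df -> cderiv (fun u => c * f u) t (c * df).
  by move=> h; have := cderivM (cderiv_cst c t) h; rewrite mul0r add0r.
have -> : (fun u => lax_matrix (p u) (a u) i j) = (fun u =>
    (p u i)%:C *+ (i == j) + z * (a u i)%:C *+ (j == i + 1) +
    z^*%C * (a u j)%:C *+ (i == j + 1)).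
  by apply/funext => u; rewrite !mxE.
rewrite !mxE; apply: cderivD; first apply: cderivD.
- exact/hn/cderiv_real.
- exact/hn/hcM/cderiv_real.
- exact/hn/hcM/cderiv_real.
Qed.

End LaxMatrix.

(** * Conjugation by the Fourier matrix *)

Section Modes.
Variables (R : realType) (n : nat) (z : R[i]).
Local Notation N := n.+2.
Local Notation I := 'I_n.+2.
Implicit Types (p a : I -> R) (i j l m : I).
Local Notation chi := (@chi R n).

Definition mode_matrix p a l m : R[i] :=
  fourier p (m - l) + fourier a (m - l) * (z^*%C * chi m + z * chi (- l)).

Definition fourier_mx : 'M[R[i]]_n.+2 := \matrix_(m, j) chi (j * m).

Let N0 : N%:R != 0 :> R. Proof. by rewrite pnatr_eq0. Qed.

(** The mode matrix enters transposed because [eigenvalue] refers to row vectors acting from the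
    left, while [is_eigenvalue] is written for columns. *)
Lemma mode_matrix_intertwine p a :
  (\matrix_(m, l) mode_matrix p a l m) *m fourier_mx =
  fourier_mx *m lax_matrix z p a.
Proof.
apply/matrixP => m j.
transitivity ((p j)%:C * chi (j * m) + z^*%C * (a j)%:C * chi ((j + 1) * m) +
   z * (a (j - 1))%:C * chi ((j - 1) * m)); last first.
  rewrite mxE (eq_bigr (fun i => (chi (i * m) * (p i)%:C) *+ (i == j) +
     (chi (i * m) * (z * (a i)%:C)) *+ (i == j - 1) +
     (chi (i * m) * (z^*%C * (a j)%:C)) *+ (i == j + 1))) => [|i _].
    by rewrite !big_split /= !sum_mulrb_eq; ring.
  by rewrite !mxE (eq_succ j) !mulrDr !mulrnAr [i == j - 1]eq_sym.
rewrite mxE.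
transitivity (\sum_l (fourier p (m - l) * chi (j * l) +
    z^*%C * chi m * (fourier a (m - l) * chi (j * l)) +
    z * (fourier a (m - l) * chi ((j - 1) * l)))); last first.
  rewrite !big_split /= -!mulr_sumr !fourier_inv_shift.
  by rewrite [(j + 1) * m]mulrDl mul1r chiD; ring.
apply: eq_bigr => l _; rewrite !mxE /mode_matrix mulrBl mul1r (chiD _ (j * l)).
by ring.
Qed.

Lemma fourier_mx_unit : fourier_mx \in unitmx.
Proof.
have h : fourier_mx *m ((N%:R^-1)%:C *: \matrix_(j, m) chi (- (j * m))) = 1%:M.
  apply/matrixP => m m'; rewrite -scalemxAr !mxE.
  rewrite (eq_bigr (fun j => chi (j * (m - m')))) => [|j _]; last first.
    by rewrite !mxE -chiD -mulrBr.
  rewrite sum_chi subr_eq0; case: eqP => _; last by rewrite mulr0.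
  by rewrite -(rmorph_nat (real_complex R)) -real_complexM mulVf.
by case: (mulmx1_unit h).
Qed.

Lemma mode_eigenvalueP p a (x : R[i]) :
  eigenvalue (lax_matrix z p a) x <->
  exists phi : I -> R[i], (exists l, phi l != 0) /\
    forall l, \sum_m mode_matrix p a l m * phi m = x * phi l.
Proof.
split.
  move/eigenvalueP => [u hu u0]; pose w := u *m invmx fourier_mx.
  have wF : w *m fourier_mx = u by rewrite mulmxKV ?fourier_mx_unit.
  exists (fun l => w ord0 l); split.
    apply/existsP; apply: contra_neqT u0; rewrite negb_exists => /forallP h.
    rewrite -wF (_ : w = 0) ?mul0mx //; apply/rowP => l; rewrite [RHS]mxE.
    by apply/eqP; move: (h l); rewrite negbK.
  move=> l; have : w *m (\matrix_(m, l) mode_matrix p a l m) = x *: w.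
    apply: (can_inj (mulmxK fourier_mx_unit)).
    by rewrite -mulmxA mode_matrix_intertwine mulmxA wF hu -scalemxAl wF.
  move/(congr1 (fun A : 'rV_ _ => A ord0 l)); rewrite mxE [RHS]mxE => <-.
  by apply: eq_bigr => m _; rewrite mulrC [X in _ = _ * X]mxE.
move=> [phi [[l0 phi0] h]]; apply/eigenvalueP.
pose w : 'rV[R[i]]_n.+2 := \row_l phi l.
have hw : w *m (\matrix_(m, l) mode_matrix p a l m) = x *: w.
  apply/rowP => l; rewrite !mxE -h.
  by apply: eq_bigr => m _; rewrite !mxE mulrC.
exists (w *m fourier_mx).
  by rewrite -mulmxA -mode_matrix_intertwine mulmxA hw -scalemxAl.
apply: contra_neq phi0 => hz0.
have : w = 0 by apply: (can_inj (mulmxK fourier_mx_unit)); rewrite hz0 mul0mx.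
by move/(congr1 (fun A : 'rV_ _ => A ord0 l0)); rewrite !mxE.
Qed.

End Modes.

(** * Unperturbed levels, their gaps, and the perturbation *)

Section FreeSpectrum.
Variables (R : realType) (n : nat) (k : 'I_n.+2).
Local Notation N := n.+2.
Local Notation I := 'I_n.+2.
Implicit Types (p a : I -> R) (l m : I).
Local Notation chi := (@chi R n).
Let z : R[i] := cis (k%:R * pi / N%:R).
Let N0 : N%:R != 0 :> R. Proof. by rewrite pnatr_eq0. Qed.

Definition free_level l : R := 2 * cos (2 * pi * l%:R / N%:R - k%:R * pi / N%:R).

(** The choice of a square root of [chi k] as phase is what makes the levels of [l] and [k - l]
    coincide, in particular those of 0 and [k]. *)
Lemma chi_twist : chi k = z * z.
Proof. by rewrite /z -cisD /chi; congr cis; field. Qed.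

Lemma twist_chi_sub l : z^*%C * chi (k - l) = z * chi (- l).
Proof.
rewrite chiD chi_twist !mulrA (mulrC z^*%C) cis_mulC mul1r //.
Qed.

Lemma free_levelE l : (free_level l)%:C = z^*%C * chi l + z * chi (- l).
Proof.
have -> : z * chi (- l) = (z^*%C * chi l)^*%C by rewrite chiN conjcM conjcK.
rewrite /z -cisN /chi -cisD addcJ /free_level real_complexM.
rewrite (rmorph_nat (real_complex R)) /=; congr (_ * (cos _)%:C).
by rewrite addrC.
Qed.

Lemma free_level_refl l : free_level (k - l) = free_level l.
Proof.
apply: (@complexI R); rewrite !free_levelE twist_chi_sub opprB addrC; congr (_ + _).
by rewrite chiD chiN chi_twist conjcM mulrCA (mulrA z) cis_mulC mul1r mulrC.
Qed.

(* cos A - cos B = - 2 sin ((A + B) / 2) sin ((A - B) / 2) *)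
Lemma free_level_diff l : free_level 0 - free_level l =
  4 * sin (l%:R * pi / N%:R) * sin (l%:R * pi / N%:R - k%:R * pi / N%:R).
Proof.
rewrite /free_level mulr0 mul0r sub0r cosN.
set x := l%:R * pi / N%:R; set y := k%:R * pi / N%:R.
have -> : 2 * pi * l%:R / N%:R - y = x + (x - y) by rewrite /x; field.
have -> : cos y = cos (x - (x - y)) by congr cos; ring.
by move: (x - y) => w; rewrite cosB cosD; ring.
Qed.

(** With u = x/2, sin x = 2 cos u sin u, and the mean value theorem gives sin u >= u cos u. Hence
    sin x >= 2 u cos^2 u = u (1 + cos x) >= u. *)
Lemma sin_ge_half (x : R) : 0 <= x <= pi / 2 -> x / 2 <= sin x.
Proof.
move=> /andP[x0 xpi]; set u := x / 2.
have u0 : 0 <= u by rewrite divr_ge0.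
have -> : sin x = 2 * (cos u * sin u).
  by rewrite mulr_natl -sin_mulr2n -mulr_natl /u; congr sin; field.
have [c] := @MVT_segment R sin cos 0 u u0 (fun x _ => is_derive_sin x)
  (continuous_subspaceT (@continuous_sin R)).
rewrite in_itv /= sin0 !subr0 => /andP[c0 cu] ->.
have cosx : 0 <= cos x.
  by apply: cos_ge0_pihalf; rewrite xpi andbT (le_trans _ x0) // oppr_le0 divr_ge0 ?pi_ge0.
have hx : cos x = 2 * cos u ^+ 2 - 1.
  by rewrite mulr_natl -cos_mulr2n -mulr_natl /u; congr cos; field.
have pi0 := pi_ge0 R.
have cosu : 0 <= cos u.
  by apply: cos_ge0_pihalf; apply/andP; split; rewrite /u; lra.
have cuc : cos u <= cos c.
  have cin : c \in `[0, pi] by rewrite in_itv /= c0 (le_trans cu) // /u; lra.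
  have uin : u \in `[0, pi] by rewrite in_itv /= u0 /u; lra.
  by rewrite leNgt; apply/negP; rewrite ltr_cos // ltNge cu.
have h1 : cos u * cos u <= cos u * cos c by rewrite ler_wpM2l.
have h2 : 1 <= 2 * (cos u * cos c) by move: hx h1; rewrite expr2; lra.
have := ler_wpM2r u0 h2; rewrite mul1r => /le_trans; apply.
by rewrite le_eqVlt; apply/orP; left; apply/eqP; ring.
Qed.

(** Below the middle this is [sin_ge_half] with pi >= 2; above it, sin (pi - x) = sin x. *)
Lemma bracket_le_sin l : (bracket N l)%:R / N%:R <= sin (l%:R * pi / N%:R : R).
Proof.
have Npos : 0 < N%:R :> R by rewrite ltr0n.
have h (m : nat) : (m <= N)%N -> (m <= N - m)%N ->
    m%:R / N%:R <= sin (m%:R * pi / N%:R : R).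
  move=> mN mNm; apply: le_trans (sin_ge_half _).
    rewrite -!mulrA ler_wpM2l // mulrCA -[leLHS]mulr1 ler_wpM2l ?invr_ge0 ?ler0n //.
    by rewrite ler_pdivlMr // mul1r pi_ge2.
  rewrite divr_ge0 ?mulr_ge0 ?pi_ge0 //= ler_pdivrMr //.
  rewrite mulrC -mulrA ler_wpM2l ?pi_ge0 // mulrC ler_pdivlMr //.
  by rewrite -natrM ler_nat; lia.
have lN := ltn_ord l; rewrite /bracket /minn; case: ifP => hl.
  by apply: h; [exact: ltnW | exact: ltnW].
have -> : sin (l%:R * pi / N%:R : R) = sin ((N - l)%:R * pi / N%:R).
  have -> : (N - l)%:R * pi / N%:R = pi - l%:R * pi / N%:R :> R.
    by rewrite natrB; [field | exact: ltnW].
  by rewrite sinB sinpi cospi mul0r sub0r mulN1r opprK.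

move/negbT: hl; rewrite -leqNgt => hl.
by apply: h; [exact: leq_subr | rewrite subKn // ltnW].
Qed.

Lemma free_level_gap l :
  4 * (bracket N l)%:R * (bracket N (k - l)%R)%:R / N%:R ^+ 2 <=
  `|free_level 0 - free_level l|.
Proof.
have e : `|sin (l%:R * pi / N%:R - k%:R * pi / N%:R : R)| =
    `|sin ((k - l)%R%:R * pi / N%:R)|.
  have lN := ltn_ord l; have kN := ltn_ord k.
  case: (leqP l k) => lk.
    have -> : nat_of_ord (k - l) = (k - l)%N.
      rewrite /= modnDmr addnBA ?(ltnW lN) // addnC -addnBA // modnDl modn_small //.
      exact: leq_ltn_trans (leq_subr _ _) kN.
    rewrite natrB // -normrN -sinN; congr `|sin _|; ring.
  have -> : nat_of_ord (k - l) = (N - (l - k))%N.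
    rewrite /= modnDmr addnC addnBAC ?(ltnW lN) // modn_small; lia.
  rewrite natrB; last lia.
  rewrite natrB; last lia.
  rewrite (_ : (N%:R - (l%:R - k%:R)) * pi / N%:R =
    pi - (l%:R * pi / N%:R - k%:R * pi / N%:R)) //; last by field.
  by rewrite [in RHS]sinB sinpi cospi mul0r sub0r mulN1r opprK.
rewrite free_level_diff !normrM e (ger0_norm (_ : 0 <= 4)) //.
rewrite (_ : _ / _ = 4 * ((bracket N l)%:R / N%:R) * ((bracket N (k - l)%R)%:R / N%:R)); last by field.
apply: ler_pM; rewrite ?mulr_ge0 ?divr_ge0 ?invr_ge0 //.
  by rewrite ler_wpM2l // (le_trans (bracket_le_sin l)) // ler_norm.
exact: le_trans (bracket_le_sin _) (ler_norm _).
Qed.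

Variables (p a : I -> R).
Local Notation alpha := (fun j => a j - 1).

(** At the equilibrium [p = 0], [a = 1] the mode matrix is diagonal with entries [free_level]; what
    remains is linear in [p] and [a - 1]. *)
Definition mode_perturbation l m : R[i] :=
  fourier p (m - l) + fourier alpha (m - l) * (z^*%C * chi m + z * chi (- l)).

Lemma mode_matrixE l m : mode_matrix z p a l m =
  (free_level l)%:C *+ (l == m) + mode_perturbation l m.
Proof.
rewrite /mode_matrix /mode_perturbation.
have -> : fourier a (m - l) = (m - l == 0)%:R + fourier alpha (m - l).
  by rewrite -fourier1 -fourierD; apply: eq_fourier => j; rewrite addrC subrK.
rewrite subr_eq0 eq_sym free_levelE.
by case: eqP => [->|_]; rewrite ?mulr1n ?mulr0n; ring.
Qed.

Lemma mode_perturbation_herm l m :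
  mode_perturbation l m = (mode_perturbation m l)^*%C.
Proof.
rewrite /mode_perturbation conjcD (conjcM (fourier alpha _)).
rewrite !fourier_conj opprB; congr (_ + _ * _).
by rewrite conjcD !conjcM conjcK !chiN !conjcK addrC -chiN.
Qed.

Lemma mode_perturbation_refl l m :
  mode_perturbation (k - l) (k - m) = (mode_perturbation l m)^*%C.
Proof.
rewrite /mode_perturbation conjcD (conjcM (fourier alpha _)) !fourier_conj.
have -> : k - m - (k - l) = - (m - l) by ring.
congr (_ + _ * _); rewrite twist_chi_sub opprB.
have -> : z * chi (l - k) = z^*%C * chi l.
  by rewrite chiD chiN chi_twist conjcM mulrCA (mulrA z) cis_mulC mul1r mulrC.
by rewrite conjcD !conjcM conjcK !chiN !conjcK addrC.
Qed.

Definition mode_bound l : R :=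
  normc (fourier p l) + 2 * normc (fourier alpha l).

Lemma mode_bound_ge0 l : 0 <= mode_bound l.
Proof. by rewrite addr_ge0 ?mulr_ge0 ?normc_ge0. Qed.

Lemma mode_boundN l : mode_bound (- l) = mode_bound l.
Proof. by rewrite /mode_bound (normc_fourierN p) (normc_fourierN alpha). Qed.

Lemma mode_perturbation_bound l m :
  normc (mode_perturbation l m) <= mode_bound (l - m).
Proof.
rewrite -mode_boundN opprB; apply: le_trans (normc_add _ _) _; rewrite lerD2l.
rewrite normcM mulrC ler_wpM2r ?normc_ge0 //.
apply: le_trans (normc_add _ _) _.
by rewrite !normcM normc_conj !normc_chi normc_cis !mulr1.
Qed.

(** To first order [a - 1] is half of [stretch q], and by [fourier_stretch] the phase turns its
    transform into i omega times that of [q]. *)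
Lemma mode_perturbation_gap :
  mode_perturbation 0 k = fourier p k + 2 * (z * fourier alpha k).
Proof.
rewrite /mode_perturbation subr0 chi_twist oppr0 chi0 mulr1 mulrA.
rewrite (mulrC z^*%C) cis_mulC mul1r; congr (_ + _); ring.
Qed.

Lemma is_eigenvalue_mode (x : R) :
  is_eigenvalue free_level mode_perturbation x <->
  eigenvalue (lax_matrix z p a) x%:C.
Proof.
rewrite mode_eigenvalueP.
have E phi l : \sum_m mode_matrix z p a l m * phi m =
    (free_level l)%:C * phi l + \sum_m mode_perturbation l m * phi m.
  under eq_bigr => m _ do rewrite mode_matrixE mulrDl mulrnAl [l == m]eq_sym.
  by rewrite big_split /= sum_mulrb_eq.
by split=> -[phi [h0 h]]; exists phi; split=> // l; have := h l; rewrite E.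
Qed.

End FreeSpectrum.

(** * The exponential in the weighted Fourier norm *)

Section WeightedFourierNorm.
Variables (R : realType) (s sigma : R) (n : nat).
Hypotheses (hs : 0 <= s) (hsigma : 0 <= sigma).
Local Notation N := n.+2.
Local Notation I := 'I_n.+2.
Local Notation W := (@weight R s sigma n).
Implicit Types x y : I -> R.

Definition wfnorm x : R := l2norm (fun l => W l * normc (fourier x l)).

Let K : R := powR 2 s * Num.sqrt N%:R.

Let W0 l : 0 <= W l. Proof. by rewrite ltW // weight_gt0. Qed.
Let K0 : 0 <= K. Proof. by rewrite mulr_ge0 ?powR_ge0 ?sqrtr_ge0. Qed.

Lemma wfnorm_ge0 x : 0 <= wfnorm x.
Proof. exact: l2norm_ge0. Qed.

Lemma eq_wfnorm x y : x =1 y -> wfnorm x = wfnorm y.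
Proof. by move=> e; apply: eq_l2norm => l; rewrite (eq_fourier _ e). Qed.

Lemma wfnormD x y : wfnorm (fun j => x j + y j) <= wfnorm x + wfnorm y.
Proof.
apply: le_trans (l2normD _ _); apply: l2norm_le => l.
rewrite ger0_norm ?mulr_ge0 ?normc_ge0 // -mulrDr ler_wpM2l //.
by rewrite fourierD normc_add.
Qed.

Lemma wfnormZ c x : wfnorm (fun j => c * x j) = `|c| * wfnorm x.
Proof.
rewrite -l2normZ //; apply: eq_l2norm => l.
by rewrite fourierZ normcM normc_real mulrCA.
Qed.

(** Young's inequality, with the l^1 norm bounded by sqrt N times the l^2 norm. This loss stays
    below the N^2 that the spectral gap imposes anyway. *)
Lemma wfnormM x y : wfnorm (fun j => x j * y j) <= K * wfnorm x * wfnorm y.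
Proof.
set F := fun l => W l * normc (fourier x l); set G := fun l => W l * normc (fourier y l).
have F0 l : 0 <= F l by rewrite mulr_ge0 ?normc_ge0.
have G0 l : 0 <= G l by rewrite mulr_ge0 ?normc_ge0.
apply: (@le_trans _ _ (l2norm (fun k => powR 2 s * \sum_l F l * G (k - l)))).
  apply: l2norm_le => k; rewrite ger0_norm ?mulr_ge0 ?normc_ge0 // fourierM.
  apply: le_trans (ler_wpM2l (W0 k) (normc_sum _)) _.
  rewrite !mulr_sumr; apply: ler_sum => l _; rewrite normcM.
  have h := weight_sub hs hsigma k l.
  apply: le_trans (ler_wpM2r _ h) _; first by rewrite mulr_ge0 ?normc_ge0.
  by rewrite /F /G le_eqVlt; apply/orP; left; apply/eqP; ring.
rewrite l2normZ ?powR_ge0 // /K -!mulrA ler_wpM2l ?powR_ge0 //.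
apply: le_trans (young_l1_l2 F0 G0) _; rewrite mulrA ler_wpM2r ?l2norm_ge0 //.
by apply: le_trans (sum_le_sqrt_card _) _; rewrite card_ord.
Qed.

Lemma wfnormX x m : wfnorm (fun j => x j ^+ m.+1) <= (K * wfnorm x) ^+ m * wfnorm x.
Proof.
elim: m => [|m IH].
  by rewrite expr0 mul1r (@eq_wfnorm _ x) // => j; rewrite expr1.
rewrite (@eq_wfnorm _ (fun j => x j * x j ^+ m.+1)) => [|j]; last by rewrite exprS.
apply: le_trans (wfnormM _ _) _; rewrite exprS -[leRHS]mulrA.
by rewrite ler_wpM2l ?mulr_ge0 ?wfnorm_ge0.
Qed.

(** The constant may depend on [N]: it only multiplies a Taylor remainder that is made arbitrarily
    small. *)
Lemma wfnorm_le_sum x : exists2 c, 0 <= c & forall y, wfnorm y <= c * \sum_j `|y j|.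
Proof.
exists (l2norm W); first exact: l2norm_ge0.
move=> y; have S0 : 0 <= \sum_j `|y j| by apply: sumr_ge0.
rewrite mulrC -l2normZ //; apply: l2norm_le => l.
rewrite ger0_norm ?mulr_ge0 ?normc_ge0 // mulrC ler_wpM2r //.
rewrite /fourier normcM normc_real ger0_norm ?invr_ge0 // -[leRHS]mul1r.
apply: ler_pM; rewrite ?invr_ge0 ?normc_ge0 ?invf_le1 ?ltr0n ?ler1n //.
apply: le_trans (normc_sum _) _; apply: ler_sum => j _.
by rewrite normcM normc_real normc_chi mulr1.
Qed.

Let expR_tail x M j : R := \sum_(i < M) x j ^+ i.+2 / (i.+2)`!%:R.

Let expR_tail_cvg x (e : R) : 0 < e -> exists M, forall j,
  `|expR (x j) - 1 - x j - expR_tail x M j| <= e.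
Proof.
move=> e0.
have h j : exists M0, forall M, (M0 <= M)%N ->
    `|expR (x j) - 1 - x j - expR_tail x M j| <= e.
  have : series (exp_coeff (x j)) @ \oo --> expR (x j).
    exact: is_cvg_series_exp_coeff.
  move/cvgrPdist_le => /(_ e e0) [M0 _ hM]; exists M0 => M MM.
  have := hM M.+2; rewrite /= => /(_ (leqW (leqW MM))).
  rewrite /series /= big_mkord 2!big_ord_recl /exp_coeff /=.
  rewrite expr0 fact0 divr1 expr1 divr1 /expR_tail.
  congr (_ <= _); congr `|_|.
  rewrite (eq_bigr (fun i : 'I_M => x j ^+ i.+2 / (i.+2)`!%:R)) => [|i _] //.
  by ring.
have [f hf] := choice h; exists (\max_j f j)%N => j.
by apply: hf; exact: leq_bigmax.
Qed.

Lemma wfnorm_expR_remainder x : K * wfnorm x <= 2^-1 ->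
  wfnorm (fun j => expR (x j) - 1 - x j) <= K * wfnorm x ^+ 2.
Proof.
move=> hK; set w := wfnorm x.
have w0 : 0 <= w by exact: wfnorm_ge0.
(* Since [K * w <= 2^-1] and 1/(M+2)! <= 1/2, the terms are dominated by a geometric series of sum
   [K * w ^+ 2]. *)
have tail M : wfnorm (expR_tail x M) <= K * w ^+ 2 * (1 - 2^-1 ^+ M).
  elim: M => [|M IH].
    rewrite expr0 subrr mulr0 (@eq_wfnorm _ (fun j => 0 * x j)).
      by rewrite wfnormZ normr0 mul0r.
    by move=> j; rewrite /expR_tail big_ord0 mul0r.
  rewrite (@eq_wfnorm _ (fun j => expR_tail x M j +
     (M.+2)`!%:R^-1 * x j ^+ M.+2)) => [|j]; last first.
    by rewrite /expR_tail big_ord_recr /= [in RHS]mulrC.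
  apply: le_trans (wfnormD _ _) _; rewrite wfnormZ ger0_norm ?invr_ge0 //.
  have h1 : (M.+2)`!%:R^-1 <= 2^-1 :> R.
    rewrite lef_pV2 ?posrE ?ltr0n ?fact_gt0 // ler_nat.
    by rewrite !factS (leq_trans _ (leq_pmulr _ _)) // muln_gt0 fact_gt0.
  have h2 : wfnorm (fun j => x j ^+ M.+2) <= K * w ^+ 2 * 2^-1 ^+ M.
    apply: le_trans (wfnormX _ _) _; rewrite -/w exprSr.
    have -> : (K * w) ^+ M * (K * w) * w = K * w ^+ 2 * (K * w) ^+ M.
      by move: ((K * w) ^+ M) => t; ring.
    rewrite ler_wpM2l ?mulr_ge0 ?exprn_ge0 //.
    by apply: lerXn2r; rewrite ?nnegrE ?mulr_ge0 ?invr_ge0.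
  have h3 := ler_pM (_ : 0 <= _) (wfnorm_ge0 _) h1 h2.
  apply: le_trans (lerD IH (h3 _)) _; first by rewrite invr_ge0.
  rewrite (exprS _ M); move: (2^-1 ^+ M) (K * w ^+ 2) => t u.
  by rewrite le_eqVlt; apply/orP; left; apply/eqP; field.
have [c c0 hc] := wfnorm_le_sum x.
apply/ler_addgt0Pr => e e0.
have e1 : 0 < e / (c * N%:R + 1).
  by rewrite divr_gt0 // ltr_wpDl // mulr_ge0.
have [M hM] := expR_tail_cvg x e1.
rewrite (@eq_wfnorm _ (fun j => expR_tail x M j +
  (expR (x j) - 1 - x j - expR_tail x M j))) => [|j]; last by rewrite [RHS]addrC subrK.
apply: le_trans (wfnormD _ _) _; apply: lerD.
  apply: le_trans (tail M) _; rewrite ler_piMr ?mulr_ge0 ?exprn_ge0 //.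
apply: le_trans (hc _) _.
apply: (@le_trans _ _ (c * \sum_(j : I) e / (c * N%:R + 1))).
  by rewrite ler_wpM2l // ler_sum.
rewrite sumr_const card_ord -[_ / _ *+ _]mulr_natl !mulrA.
have cN : 0 < c * N%:R + 1 by rewrite ltr_wpDl // mulr_ge0.
by rewrite ler_pdivrMr // [leLHS]mulrC ler_wpM2l ?lerDl // ltW.
Qed.

End WeightedFourierNorm.

(** * Normal modes and the coupling of a resonant pair *)

Section NormalModes.
Variables (R : realType) (s sigma : R) (n : nat).
Hypotheses (hs : 0 <= s) (hsigma : 0 <= sigma).
Local Notation N := n.+2.
Local Notation I := 'I_n.+2.
Local Notation W := (@weight R s sigma n).
Local Notation chi := (@chi R n).
Implicit Types (p q : I -> R) (k l : I).

Let N0 : N%:R != 0 :> R. Proof. by rewrite pnatr_eq0. Qed.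
Let W0 l : 0 <= W l. Proof. by rewrite ltW // weight_gt0. Qed.

Definition normal_mode p q k : R[i] :=
  fourier p k + 'i%C * (omega R N k)%:C * fourier q k.

Definition normal_norm p q : R := l2norm (fun k => W k * normc (normal_mode p q k)).

Definition stretch q : I -> R := fun j => q j - q (j + 1).

Lemma omega0 : omega R N 0 = 0.
Proof. by rewrite /omega !mul0r sin0 mulr0. Qed.

Lemma omegaN k : omega R N (- k)%R = omega R N k.
Proof.
have [->|k0] := eqVneq k 0; first by rewrite oppr0.
rewrite val_oppI // /omega; congr (_ * _).
rewrite (_ : _ / _ = pi - k%:R * pi / N%:R); last first.
  by rewrite natrB; [field | exact: ltnW].
by rewrite sinB sinpi cospi mul0r sub0r mulN1r opprK.
Qed.

Lemma normal_modeN p q k : (normal_mode p q (- k))^*%C =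
  fourier p k - 'i%C * (omega R N k)%:C * fourier q k.
Proof.
rewrite /normal_mode conjcD (conjcM (_ * _)) (conjcM 'i%C) !fourier_conj !opprK.
rewrite conjc_real omegaN -!mulNr; congr (_ + _ * _ * _).
by apply/eqP; rewrite eq_complex /= oppr0 !eqxx.
Qed.

Lemma normal_mode_zero p q : \sum_j p j = 0 -> normal_mode p q 0 = 0.
Proof.
move=> hp; rewrite /normal_mode omega0 mulr0 mul0r addr0 /fourier.
rewrite (eq_bigr (fun j => (p j)%:C)) => [|j _]; last by rewrite mulr0 chi0 mulr1.
by rewrite -real_complex_sum hp mulr0.
Qed.

(** The half-angle phase symmetrises the difference operator: z (1 - conj(z)^2) = z - conj(z) = i
    omega. *)
Lemma fourier_stretch q k :
  cis (k%:R * pi / N%:R) * fourier (stretch q) k =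
  'i%C * (omega R N k)%:C * fourier q k.
Proof.
set z := cis _.
have -> : fourier (stretch q) k = (1 - chi (- k)) * fourier q k.
  rewrite (@eq_fourier _ _ _ (fun j => q j + (-1) * q (j + 1))) => [|j]; last first.
    by rewrite mulN1r.
  rewrite fourierD fourierZ fourier_shift rmorphN rmorph1; ring.
rewrite mulrA mulrBr mulr1 chiN chi_twist conjcM -/z (mulrA z) cis_mulC mul1r.
congr (_ * _); apply/eqP; rewrite eq_complex /= /omega.
by apply/andP; split; apply/eqP; ring.
Qed.

Lemma normc_half (w : R[i]) (x : R) : normc (2 * w) <= x -> normc w <= 2^-1 * x.
Proof.
have -> : 2 = (2 : R)%:C by rewrite (rmorph_nat (real_complex R)).
rewrite normcM normc_real ger0_norm // => h; lra.
Qed.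

Let reflect_average p q : l2norm (fun k => 2^-1 *
  (W k * normc (normal_mode p q k) + W (- k) * normc (normal_mode p q (- k)))) <=
  normal_norm p q.
Proof.
rewrite l2normZ ?invr_ge0 //.
have := l2normD (fun k => W k * normc (normal_mode p q k))
  (fun k => W (- k) * normc (normal_mode p q (- k))).
rewrite (l2norm_opp (fun k => W k * normc (normal_mode p q k))) -/(normal_norm p q).
by move=> h; lra.
Qed.

(** The normal mode at [k] and the conjugate of the one at [- k] differ only in the sign of the [q]
    part. Their half sum isolates [p], their half difference the stretch, and averaging over
    reflection does not increase the norm. *)
Lemma wfnorm_momentum p q : wfnorm s sigma p <= normal_norm p q.
Proof.
apply: le_trans (reflect_average p q); apply: l2norm_le => k.
rewrite ger0_norm ?mulr_ge0 ?normc_ge0 // weightN -mulrDr mulrCA ler_wpM2l //.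
apply: normc_half; rewrite -(normc_conj (normal_mode p q (- k))).
apply: le_trans (normc_add _ _); rewrite normal_modeN /normal_mode.
by rewrite le_eqVlt; apply/orP; left; apply/eqP; congr normc; ring.
Qed.

Lemma wfnorm_stretch p q : wfnorm s sigma (stretch q) <= normal_norm p q.
Proof.
apply: le_trans (reflect_average p q); apply: l2norm_le => k.
rewrite ger0_norm ?mulr_ge0 ?normc_ge0 // weightN -mulrDr mulrCA ler_wpM2l //.
have -> : normc (fourier (stretch q) k) =
    normc ('i%C * (omega R N k)%:C * fourier q k).
  by rewrite -fourier_stretch (normcM (cis _)) normc_cis mul1r.
apply: normc_half; rewrite -(normc_conj (normal_mode p q (- k))).
rewrite -(normc_opp (_^*%C)).
apply: le_trans (normc_add _ _); rewrite normal_modeN /normal_mode.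
by rewrite le_eqVlt; apply/orP; left; apply/eqP; congr normc; ring.
Qed.

Section Bounds.
Variables (p q : I -> R) (x : R).
Hypothesis norm_le : normal_norm p q <= x.
Let g : R := powR 2 s * N%:R ^+ 2 * x.
Hypothesis small : g <= 40^-1.

Definition flaschka : I -> R := fun j => expR (2^-1 * stretch q j).
Definition exp_remainder : I -> R :=
  fun j => expR (2^-1 * stretch q j) - 1 - 2^-1 * stretch q j.

Let x0 : 0 <= x. Proof. exact: le_trans (l2norm_ge0 _) norm_le. Qed.
Let g0 : 0 <= g. Proof. by rewrite !mulr_ge0 ?powR_ge0. Qed.

Let half_stretch : wfnorm s sigma (fun j => 2^-1 * stretch q j) <= 2^-1 * x.
Proof.
rewrite wfnormZ ger0_norm ?invr_ge0 // ler_wpM2l ?invr_ge0 //.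
exact: le_trans (wfnorm_stretch p q) norm_le.
Qed.

Let K_le : powR 2 s * Num.sqrt N%:R * x <= g.
Proof.
rewrite ler_wpM2r // ler_wpM2l ?powR_ge0 //.
rewrite -[leRHS](ger0_norm (_ : 0 <= _)) ?exprn_ge0 // -sqrtr_sqr.
apply: ler_wsqrtr; rewrite -exprM -natrX ler_nat.
by rewrite -{1}(expn1 N) leq_exp2l.
Qed.

Lemma wfnorm_exp_remainder : wfnorm s sigma exp_remainder <= g * x / 4.
Proof.
have h : powR 2 s * Num.sqrt N%:R * wfnorm s sigma (fun j => 2^-1 * stretch q j) <= 2^-1.
  apply: (@le_trans _ _ (powR 2 s * Num.sqrt N%:R * (2^-1 * x))).
    by rewrite ler_wpM2l ?mulr_ge0 ?powR_ge0 ?sqrtr_ge0.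
  by rewrite mulrCA; have := K_le; have := small; move: (_ * x) => t; lra.
apply: le_trans (wfnorm_expR_remainder hs hsigma h) _.
have h2 : wfnorm s sigma (fun j => 2^-1 * stretch q j) ^+ 2 <= (2^-1 * x) ^+ 2.
  by rewrite ler_pXn2r ?nnegrE ?wfnorm_ge0 ?mulr_ge0 ?invr_ge0.
apply: le_trans (ler_wpM2l _ h2) _; first by rewrite mulr_ge0 ?powR_ge0 ?sqrtr_ge0.
have -> : powR 2 s * Num.sqrt N%:R * (2^-1 * x) ^+ 2 =
   powR 2 s * Num.sqrt N%:R * x * x / 4.
  by move: (powR _ _ * _) => t; field.
by rewrite ler_wpM2r ?invr_ge0 // ler_wpM2r.
Qed.

Let gx : g * x <= 40^-1 * x. Proof. by rewrite ler_wpM2r. Qed.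

(** The momentum gives x, the linear part of [flaschka] minus 1 gives 2 * (x / 2), and the remainder
    fits into a third x. *)
Lemma mode_bound_norm : l2norm (fun l => W l * mode_bound p flaschka l) <= 3 * x.
Proof.
have h1 : wfnorm s sigma (fun j => flaschka j - 1) <= 2^-1 * x + g * x / 4.
  rewrite (@eq_wfnorm _ _ _ _ _ (fun j => 2^-1 * stretch q j + exp_remainder j)).
    exact: le_trans (wfnormD _ _ _ _) (lerD half_stretch wfnorm_exp_remainder).
  by move=> j; rewrite /exp_remainder /flaschka; ring.
apply: (@le_trans _ _ (wfnorm s sigma p + 2 * wfnorm s sigma (fun j => flaschka j - 1))).
  rewrite -l2normZ //; apply: le_trans (l2normD _ _).
  rewrite le_eqVlt; apply/orP; left; apply/eqP; apply: eq_l2norm => l.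
  by rewrite /mode_bound; move: (normc _) (normc _) => u v; ring.
have h2 := le_trans (wfnorm_momentum p q) norm_le.
have := gx; move: (g * x) h1 => t h1; have := x0; lra.
Qed.

Let nu : R := l2norm (fun l => W l * mode_bound p flaschka l).

Lemma mode_bound_small : N%:R ^+ 2 * nu * powR 2 s <= 3 * g.
Proof.
have -> : 3 * g = N%:R ^+ 2 * (3 * x) * powR 2 s.
  by rewrite /g; move: (powR _ _) (_ ^+ 2) => u v; ring.
by rewrite ler_wpM2r ?powR_ge0 // ler_wpM2l // mode_bound_norm.
Qed.

Lemma mode_bound_small8 : N%:R ^+ 2 * nu * powR 2 s <= 8^-1.
Proof. apply: le_trans mode_bound_small _; have := small; lra. Qed.

Definition mode_error : I -> R := feshbach_error (mode_bound p flaschka) s sigma.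

Lemma l2norm_mode_error : l2norm mode_error <= 18 * (g * x).
Proof.
have nu0 : 0 <= nu by exact: l2norm_ge0.
have k0 : 0 <= N%:R ^+ 2 * nu * powR 2 s by rewrite mulr_ge0 ?powR_ge0 ?mulr_ge0.
apply: le_trans (l2norm_feshbach_error hs hsigma (mode_bound_ge0 p flaschka)
  mode_bound_small8) _.
have h := ler_pM k0 nu0 mode_bound_small mode_bound_norm.
have -> : 18 * (g * x) = 2 * (3 * g * (3 * x)) by ring.
by rewrite -mulrA ler_wpM2l.
Qed.

Lemma mode_gap_close k :
  `|normc (mode_perturbation k p flaschka 0 k) - normc (normal_mode p q k)| <=
  2 * normc (fourier exp_remainder k).
Proof.
apply: le_trans (normc_sub _ _) _; rewrite mode_perturbation_gap.
have -> : fourier (fun j => flaschka j - 1) k =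
    (2^-1)%:C * fourier (stretch q) k + fourier exp_remainder k.
  rewrite -fourierZ -fourierD; apply: eq_fourier => j.
  by rewrite /exp_remainder /flaschka; ring.
rewrite /normal_mode -fourier_stretch; set z := cis _.
have -> : (2^-1)%:C = 2^-1 :> R[i] by rewrite fmorphV rmorph_nat.
have two0 : 2 != 0 :> R[i] by rewrite pnatr_eq0.
rewrite [X in normc X](_ : _ = 2 * (z * fourier exp_remainder k)); last first.
  by move: (fourier p k) (fourier (stretch q) k) (fourier exp_remainder k) z => u1 u2 u3 u4; field.
have -> : 2 = (2 : R)%:C by rewrite (rmorph_nat (real_complex R)).
by rewrite normcM normc_real ger0_norm // (normcM z) normc_cis mul1r.
Qed.

End Bounds.
End NormalModes.

(** * Conservation of the normal mode norm *)

(** The 9 comes from (1 + 3 G) / (1 - 3 G) <= 1 + 9 G, valid for 0 <= G <= 1/9. *)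
Lemma width_comparison (R : realType) (c c' e e' G w kap kap' : R) :
  0 <= w -> 0 <= c' + e' -> 0 <= G -> G <= 40^-1 ->
  kap <= 3 * G -> kap' <= 3 * G ->
  2 * (c - e) <= (1 + kap) * w -> (1 - kap') * w <= 2 * (c' + e') ->
  c - e <= (1 + 9 * G) * (c' + e').
Proof.
move=> w0 ce0 G0 Gs hk hk' low up.
have h1 : 2 * (c - e) <= (1 + 3 * G) * w.
  by apply: le_trans low _; rewrite ler_wpM2r // lerD2l.
have h2 : (1 - 3 * G) * w <= 2 * (c' + e').
  by apply: le_trans up; rewrite ler_wpM2r // lerD2l lerN2.
have h3 : 0 < 1 - 3 * G by lra.
rewrite -(ler_pM2l h3).
have h4 : (1 + 3 * G) * ((1 - 3 * G) * w) <= (1 + 3 * G) * (2 * (c' + e')).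
  by rewrite ler_wpM2l //; lra.
have h5 : (1 - 3 * G) * (2 * (c - e)) <= (1 - 3 * G) * ((1 + 3 * G) * w).
  by rewrite ler_wpM2l // ltW.
have h6 : (1 + 3 * G) * (c' + e') <= (1 - 3 * G) * ((1 + 9 * G) * (c' + e')).
  rewrite mulrA ler_wpM2r // -subr_ge0.
  have -> : (1 - 3 * G) * (1 + 9 * G) - (1 + 3 * G) = 3 * (G * (1 - 9 * G)) by ring.
  by rewrite !mulr_ge0 //; lra.
move: h4 h5; rewrite [(1 + 3 * G) * ((1 - 3 * G) * w)]mulrCA.
move: (_ * (_ * w)) => y h4 h5.
have -> : (1 - 3 * G) * (c - e) = (1 - 3 * G) * (2 * (c - e)) / 2 by field.
apply: le_trans h6; rewrite ler_pdivrMr //.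
apply: le_trans h5 (le_trans h4 _).
by rewrite le_eqVlt; apply/orP; left; apply/eqP; ring.
Qed.

Lemma comparison_ge0 (R : realType) (a b c d e G : R) :
  0 <= a -> 0 <= b -> 0 <= c -> 0 <= d -> 0 <= e -> 0 <= G ->
  0 <= a + (2 * b + G * (c + (2 * d + e))).
Proof. by move=> *; rewrite !(addr_ge0, mulr_ge0). Qed.

Lemma pointwise_comparison (R : realType) (w c c' e e' y y' r r' G : R) :
  0 <= w -> 0 <= G -> `|c' - y'| <= 2 * r' -> `|c - y| <= 2 * r ->
  c - e <= G * (c' + e') ->
  w * y <= w * e + (2 * (w * r) + G * (w * y' + (2 * (w * r') + w * e'))).
Proof.
move=> w0 G0; rewrite !ler_norml => /andP[_ h1] /andP[h2 _] h3.
rewrite [leRHS](_ : _ = w * (e + (2 * r + G * (y' + (2 * r' + e'))))); last by ring.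
rewrite ler_wpM2l //.
have h4 : G * (c' + e') <= G * (y' + (2 * r' + e')) by rewrite ler_wpM2l //; lra.
by move: h3 h4; move: (G * _) (G * _) => u v h3 h4; lra.
Qed.

(** With 1 + 9 g <= 2, the error in units of g x is at most 18 + 1/2 + 9 + 2 * (37/2), which is
    below 65. *)
Lemma norm_comparison_arith (R : realType) (g x A A' B B' Z : R) :
  0 <= g -> g <= 40^-1 -> 0 <= g * x -> Z <= x ->
  B' <= g * x / 4 -> B <= g * x / 4 -> A' <= 18 * (g * x) -> A <= 18 * (g * x) ->
  A' + (2 * B' + (1 + 9 * g) * (Z + (2 * B + A))) <= Z + 65 * (g * x).
Proof.
move=> g0 small gx0 Zx h1 h2 h3 h4.
have gZ : g * Z <= g * x by rewrite ler_wpM2l.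
have h5 : (1 + 9 * g) * (Z + (2 * B + A)) <= Z + 9 * (g * x) + 2 * (37 / 2 * (g * x)).
  have -> : (1 + 9 * g) * (Z + (2 * B + A)) = Z + 9 * (g * Z) + (1 + 9 * g) * (2 * B + A) by ring.
  apply: lerD; first by rewrite lerD2l ler_wpM2l.
  apply: (@le_trans _ _ ((1 + 9 * g) * (37 / 2 * (g * x)))).
    by rewrite ler_wpM2l //; lra.
  have t0 : 0 <= 37 / 2 * (g * x) by move: (g * x) gx0 => t *; lra.
  by rewrite ler_wpM2r //; lra.
move: h5; move: (_ * (Z + _)) => u h5.
move: (g * x) gx0 h1 h2 h3 h4 h5 {gZ} => t gx0 h1 h2 h3 h4 h5.
lra.
Qed.

Section Comparison.
Variables (R : realType) (s sigma : R) (n : nat).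
Hypotheses (hs : 0 <= s) (hsigma : 0 <= sigma).
Local Notation N := n.+2.
Local Notation I := 'I_n.+2.
Local Notation W := (@weight R s sigma n).
Local Notation twist k := (cis (k%:R * pi / N%:R) : R[i]).
Implicit Types (k l : I).

Lemma feshbach_error_ge0 (v : I -> R) k : (forall l, 0 <= v l) ->
  0 <= feshbach_error v s sigma k.
Proof.
move=> v0; have W0 l : 0 <= W l by rewrite ltW // weight_gt0.
rewrite /feshbach_error mulr_ge0 ?mulr_ge0 ?powR_ge0 ?invr_ge0 //.
apply: sumr_ge0 => l _; rewrite mulr_ge0 ?mulr_ge0 ?inv_bracket_ge0 //.
by rewrite addr_ge0 ?mulr_ge0 ?l2norm_ge0 ?powR_ge0.
Qed.

Variables (p q p' q' : I -> R) (x : R).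
Hypotheses (hp : \sum_j p j = 0) (le : normal_norm s sigma p q <= x)
  (le' : normal_norm s sigma p' q' <= x).
Let g : R := powR 2 s * N%:R ^+ 2 * x.
Hypothesis small : g <= 40^-1.
Hypothesis isospectral : forall k (lam : R[i]),
  eigenvalue (lax_matrix (twist k) p (flaschka q)) lam ->
  eigenvalue (lax_matrix (twist k) p' (flaschka q')) lam.

Let W0 l : 0 < W l. Proof. by rewrite weight_gt0. Qed.
Let x0 : 0 <= x. Proof. exact: le_trans (l2norm_ge0 _) le. Qed.
Let g0 : 0 <= g. Proof. by rewrite !mulr_ge0 ?powR_ge0. Qed.
Local Notation err := (mode_error s sigma p q).
Local Notation err' := (mode_error s sigma p' q').
Local Notation rem := (fun k => W k * normc (fourier (exp_remainder q) k)).
Local Notation rem' := (fun k => W k * normc (fourier (exp_remainder q') k)).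

(** The two eigenvalues realising the lower bound for [(p, q)] are eigenvalues for [(p', q')] as
    well, and the upper bound holds for any two eigenvalues in the window. One inclusion of spectra
    thus suffices, without labels or multiplicities. *)
Lemma gap_comparison k : k != 0 ->
  normc (mode_perturbation k p (flaschka q) 0 k) - err k / W k <=
  (1 + 9 * g) *
    (normc (mode_perturbation k p' (flaschka q') 0 k) + err' k / W k).
Proof.
move=> k0.
have [lam [mu [hl hm el em low]]] := cluster_width_lower hs hsigma k0
  (free_level_refl R k) (free_level_gap R k)
  (mode_perturbation_herm k p (flaschka q)) (mode_perturbation_refl k p (flaschka q))
  (mode_bound_ge0 p (flaschka q)) (mode_boundN p (flaschka q))
  (mode_perturbation_bound k p (flaschka q)) (mode_bound_small8 hs hsigma le small).
have iso y : is_eigenvalue (free_level R k) (mode_perturbation k p (flaschka q)) y ->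
    is_eigenvalue (free_level R k) (mode_perturbation k p' (flaschka q')) y.
  by move=> /is_eigenvalue_mode h; apply/is_eigenvalue_mode; exact: isospectral.
have up := cluster_width_upper hs hsigma k0
  (free_level_refl R k) (free_level_gap R k)
  (mode_perturbation_herm k p' (flaschka q')) (mode_perturbation_refl k p' (flaschka q'))
  (mode_bound_ge0 p' (flaschka q')) (mode_boundN p' (flaschka q'))
  (mode_perturbation_bound k p' (flaschka q')) (mode_bound_small8 hs hsigma le' small)
  hl hm (iso _ el) (iso _ em).
move: low up (mode_bound_small hs hsigma le small) (mode_bound_small hs hsigma le' small).
rewrite -/g /mode_error.
move=> low up hk hk'.
apply: width_comparison g0 small hk hk' low up; first exact: normr_ge0.
rewrite addr_ge0 ?normc_ge0 // divr_ge0 ?(ltW (W0 _)) // feshbach_error_ge0 //.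
by move=> l; exact: mode_bound_ge0.
Qed.

Lemma normal_norm_comparison :
  normal_norm s sigma p q <= normal_norm s sigma p' q' + 65 * (g * x).
Proof.
have err0 k : 0 <= err k by apply: feshbach_error_ge0 => l; exact: mode_bound_ge0.
have err0' k : 0 <= err' k by apply: feshbach_error_ge0 => l; exact: mode_bound_ge0.
have c0 : 0 <= 1 + 9 * g by have := g0; lra.
have pt k : `|W k * normc (normal_mode p q k)| <=
   err k + (2 * rem k + (1 + 9 * g) *
     (W k * normc (normal_mode p' q' k) + (2 * rem' k + err' k))).
  rewrite ger0_norm ?mulr_ge0 ?normc_ge0 ?(ltW (W0 _)) //.
  (* Mode 0 has no resonant partner, but its normal mode vanishes with the total momentum. *)
  have [->|k0] := eqVneq k 0.
    rewrite normal_mode_zero // normc0 mulr0.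
    have a0 (w : R[i]) : 0 <= W 0 * normc w by rewrite mulr_ge0 ?normc_ge0 // ltW.
    exact: (comparison_ge0 (err0 0) (a0 _) (a0 _) (a0 _) (err0' 0) c0).
  have Wn : W k != 0 by rewrite gt_eqF.
  have -> : err k = W k * (err k / W k) by rewrite mulrC divfK.
  have -> : err' k = W k * (err' k / W k) by rewrite mulrC divfK.
  exact: (pointwise_comparison (ltW (W0 k)) c0 (mode_gap_close p' q' k)
    (mode_gap_close p q k) (gap_comparison k0)).
have rem_le : l2norm rem <= g * x / 4 by exact: wfnorm_exp_remainder le small.
have rem_le' : l2norm rem' <= g * x / 4 by exact: wfnorm_exp_remainder le' small.
have err_le := l2norm_mode_error hs hsigma le small.
have err_le' := l2norm_mode_error hs hsigma le' small.
apply: le_trans (l2norm_le pt) _.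
apply: le_trans (l2normD _ _) _.
apply: le_trans (lerD (lexx _) (l2normD _ _)) _.
rewrite (@l2normZ _ _ 2 rem) // (@l2normZ _ _ (1 + 9 * g)) //.
apply: le_trans (lerD (lexx _) (lerD (lexx _) (ler_wpM2l c0 (l2normD _ _)))) _.
apply: le_trans (lerD (lexx _) (lerD (lexx _) (ler_wpM2l c0 (lerD (lexx _) (l2normD _ _))))) _.
rewrite (@l2normZ _ _ 2 rem') // -/(normal_norm s sigma p' q').
have gx0 : 0 <= g * x by exact: mulr_ge0.
exact: (norm_comparison_arith g0 small gx0 le' rem_le rem_le' err_le err_le').
Qed.

End Comparison.

(** * The Toda flow *)

Section HamiltonVectorField.
Variables (R : realType) (n : nat).
Local Notation N := n.+2.
Local Notation I := 'I_n.+2.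

(** This brings the partial derivatives in Hamilton's equations down to calculus in one real
    variable. *)
Lemma derive_line (V : normedModType R) (f : V -> R) (x v : V) :
  'D_v f x = 'D_1 (fun h : R => f (h *: v + x)) 0.
Proof.
have e : (fun h : R => h^-1 *: ((f \o shift x) (h *: v) - f x)) =
    (fun h : R => h^-1 *: (((fun u : R => f (u *: v + x)) \o shift 0) (h *: (1 : R))
                           - f (0 *: v + x))).
  by apply/funext => h; rewrite /shift /= addr0 scale0r add0r [h *: 1]mulr1.
by rewrite /derive e.
Qed.

Lemma is_derive_bigsum (J : Type) (r : seq J) (F : J -> R -> R) (t : R) (dF : J -> R) :
  (forall i, is_derive t 1 (F i) (dF i)) ->
  is_derive t 1 (fun u => \sum_(i <- r) F i u) (\sum_(i <- r) dF i).
Proof.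
move=> h; elim: r => [|i r IH].
  rewrite big_nil; have -> : (fun u => \sum_(i <- [::]) F i u) = cst 0.
    by apply/funext => u; rewrite big_nil.
  exact: is_derive_cst.
rewrite big_cons.
have -> : (fun u => \sum_(j <- i :: r) F j u) = F i + (fun u => \sum_(j <- r) F j u).
  by apply/funext => u; rewrite big_cons.
exact: is_deriveD.
Qed.

Lemma ordSE (j : I) : ordS j = j + 1.
Proof. by apply: val_inj; rewrite /= addn1. Qed.

Lemma is_derive_affine (a b t : R) : is_derive t 1 (fun h => a * h + b) a.
Proof.
have h := is_deriveD (is_deriveZ a (is_derive_id t (1 : R))) (is_derive_cst b t (1 : R)).
by apply: is_derive_congr h => //; rewrite addr0 [_ *: _]mulr1.
Qed.

Lemma is_derive_expR_comp (f : R -> R) (t df : R) :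
  is_derive t 1 f df -> is_derive t 1 (fun u => expR (f u)) (expR (f t) * df).
Proof. by move=> h; exact: (is_derive1_comp (is_derive_expR _) h). Qed.

Lemma derive_hamiltonian_p (p q : 'rV[R]_N) (j : I) :
  'D_(delta_mx ord0 j) (fun y => toda_hamiltonian y q) p = p ord0 j.
Proof.
rewrite derive_line; apply: derive_val.
pose c : R := \sum_(i < N) expR (q ord0 i - q ord0 (ordS i)).
have key : is_derive (0 : R) 1 (fun h : R => 2^-1 *
    (\sum_(i < N) ((i == j)%:R * h + p ord0 i) ^+ 2) + c)
    (2^-1 * (\sum_(i < N) (2 * p ord0 i * (i == j)%:R)) + 0).
  apply: is_deriveD; apply: is_deriveZ; apply: is_derive_bigsum => i.
  apply: is_derive_congr (is_deriveX 2 (is_derive_affine (i == j)%:R (p ord0 i) 0)) => //.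
  by rewrite /GRing.scale /= mulr0 add0r expr1 -mulr_natl.
apply: is_derive_congr key => [h|].
  rewrite /toda_hamiltonian; congr (_ * _ + _); apply: eq_bigr => i _.
  by rewrite !mxE /= mulrC.
rewrite addr0 (bigD1 j) //= eqxx mulr1 big1 ?addr0 => [|i /negbTE ->].
  by rewrite mulrA mulVf ?mul1r.
by rewrite mulr0.
Qed.

Lemma derive_hamiltonian_q (p q : 'rV[R]_N) (j : I) :
  'D_(delta_mx ord0 j) (fun x => toda_hamiltonian p x) q =
  expR (q ord0 j - q ord0 (j + 1)) - expR (q ord0 (j - 1) - q ord0 j).
Proof.
rewrite derive_line; apply: derive_val.
pose c : R := 2^-1 * (\sum_(i < N) p ord0 i ^+ 2).
(* The rate of change of q_i - q_(i+1) when only q_j moves: the terms i = j and i = j - 1 contribute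
   with opposite signs. *)
pose e (i : I) : R := (i == j)%:R - (i + 1 == j)%:R.
pose d (i : I) : R := q ord0 i - q ord0 (i + 1).
have key : is_derive (0 : R) 1 (fun h : R => c + \sum_(i < N) expR (e i * h + d i))
    (0 + \sum_(i < N) expR (e i * 0 + d i) * e i).
  apply: is_deriveD; apply: is_derive_bigsum => i.
  exact: is_derive_expR_comp (is_derive_affine _ _ _).
apply: is_derive_congr key => [h|].
  rewrite /toda_hamiltonian; congr (_ + _); apply: eq_bigr => i _.
  by rewrite !mxE /= ordSE /e /d; congr expR; ring.
rewrite add0r.
have -> : \sum_(i < N) expR (e i * 0 + d i) * e i =
    \sum_(i < N) (expR (d i) * (i == j)%:R - expR (d i) * (i == j - 1)%:R).
  by apply: eq_bigr => i _; rewrite mulr0 add0r mulrBr -eq_succ (eq_sym j).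
rewrite sumrB; congr (_ - _).
  rewrite (bigD1 j) //= eqxx mulr1 big1 ?addr0 => [|i /negbTE ->] //.
  by rewrite mulr0.
rewrite (bigD1 (j - 1)) //= eqxx mulr1 big1 ?addr0 => [|i /negbTE ->].
  by rewrite /d subrK.
by rewrite mulr0.
Qed.

Variables p q : R -> 'rV[R]_N.
Hypothesis sol : toda_solution p q.
Local Notation pf t := (fun j : I => p t ord0 j).
Local Notation qf t := (fun j : I => q t ord0 j).

Lemma toda_is_derive_q (t : R) (j : I) :
  is_derive t 1 (fun u => q u ord0 j) (p t ord0 j).
Proof. by have [_ _ /(_ j) [+ _]] := sol t; rewrite derive_hamiltonian_p. Qed.

Lemma toda_is_derive_p (t : R) (j : I) : is_derive t 1 (fun u => p u ord0 j)
  (flaschka (qf t) (j - 1) ^+ 2 - flaschka (qf t) j ^+ 2).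
Proof.
have [_ _ /(_ j) [_ +]] := sol t; rewrite derive_hamiltonian_q opprB.
have e i : flaschka (qf t) i ^+ 2 = expR (q t ord0 i - q t ord0 (i + 1)).
  by rewrite /flaschka expr2 -expRD -mulrDl /stretch; congr expR; field.
by rewrite !e subrK.
Qed.

Lemma toda_is_derive_flaschka (t : R) (j : I) :
  is_derive t 1 (fun u => flaschka (qf u) j)
    (flaschka (qf t) j * (p t ord0 j - p t ord0 (j + 1)) / 2).
Proof.
have h := is_deriveZ 2^-1 (is_deriveB (toda_is_derive_q t j) (toda_is_derive_q t (j + 1))).
apply: is_derive_congr (is_derive_expR_comp h) => [u|].
  by rewrite /flaschka /stretch.
by rewrite -mulrA; congr (_ * _); rewrite mulrC.
Qed.

Lemma toda_isospectral (z : R[i]) (t u : R) (lam : R[i]) : z * z^*%C = 1 ->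
  eigenvalue (lax_matrix z (pf t) (flaschka (qf t))) lam ->
  eigenvalue (lax_matrix z (pf u) (flaschka (qf u))) lam.
Proof.
move=> hz; apply: (@lax_eigenvalue _ _
  (fun t => lax_matrix z (pf t) (flaschka (qf t)))
  (fun t => lax_flow z (flaschka (qf t)))) => [x|x i j].
  apply: (@mderiv_lax _ _ z hz (fun t => pf t) (fun t => flaschka (qf t))) => i.
    exact: toda_is_derive_p.
  exact: toda_is_derive_flaschka.
exact: lax_matrix_herm.
Qed.

End HamiltonVectorField.

(** * The phase norm in terms of normal modes *)

Section PhaseNorm.
Variables (R : realType) (s sigma : R) (n : nat).
Local Notation N := n.+2.
Local Notation I := 'I_n.+2.
Local Notation W := (@weight R s sigma n).
Implicit Types (p q : 'rV[R]_n.+2) (k : I).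
Local Notation fn p := (fun j : I => p ord0 j).

Lemma normc_parallelogram (a b : R[i]) :
  normc (a + b) ^+ 2 + normc (a - b) ^+ 2 = 2 * (normc a ^+ 2 + normc b ^+ 2).
Proof. by rewrite !sqr_normc; case: a => a1 a2; case: b => b1 b2 /=; ring. Qed.

Lemma dft_fourier p k : dft p k = (Num.sqrt N%:R)%:C * fourier (fn p) k.
Proof.
rewrite /dft /fourier [RHS]mulrA -real_complexM; congr (_%:C * _).
  have h : Num.sqrt N%:R != 0 :> R by rewrite sqrtr_eq0 -ltNge ltr0n.
  by rewrite -{3}(sqr_sqrtr (ler0n R N)) expr2 invfM mulrA mulfV // mul1r.
by apply: eq_bigr => j _; rewrite chi_mul.
Qed.

(** For real sequences eta_k is the conjugate of xi_k, so both have the modulus of the normal mode,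
    up to a common factor; the parallelogram law passes to X and Y. *)
Lemma coord_energy p q k : k != 0 ->
  omega R N k * ((normc (coordX p q k) ^+ 2 + normc (coordY p q k) ^+ 2) / 2) =
  N%:R * (normc (normal_mode (fn p) (fn q) k) ^+ 2 / 2).
Proof.
move=> k0.
have w0 : 0 < omega R N k by rewrite mulr_gt0 // sin_mode_gt0.
have s2 : normc (Num.sqrt 2 : R)%:C ^+ 2 = 2.
  by rewrite normc_real real_normK ?num_real // sqr_sqrtr.
have sw : normc (Num.sqrt (2 * omega R N k))%:C ^+ 2 = 2 * omega R N k.
  by rewrite normc_real real_normK ?num_real // sqr_sqrtr // mulr_ge0 // ltW.
have si : normc 'i%C = 1 :> R by rewrite /= expr0n expr1n add0r sqrtr1.
have sN : normc (Num.sqrt N%:R : R)%:C ^+ 2 = N%:R.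
  by rewrite normc_real real_normK ?num_real // sqr_sqrtr.
have eX : normc (xi p q k) ^+ 2 =
    N%:R * normc (normal_mode (fn p) (fn q) k) ^+ 2 / (2 * omega R N k).
  rewrite /xi normcM normcV exprMn exprVn sw; congr (_ / _).
  rewrite !dft_fourier (_ : _ + _ = (Num.sqrt N%:R)%:C * normal_mode (fn p) (fn q) k).
    by rewrite (normcM (Num.sqrt _)%:C) exprMn sN.
  by rewrite /normal_mode; ring.
have eY : normc (eta p q k) ^+ 2 =
    N%:R * normc (normal_mode (fn p) (fn q) k) ^+ 2 / (2 * omega R N k).
  rewrite /eta normcM normcV exprMn exprVn sw; congr (_ / _).
  rewrite -(val_oppI k0) !dft_fourier -(normc_conj (normal_mode _ _ _)).
  rewrite (_ : _ - _ = (Num.sqrt N%:R)%:C * (normal_mode (fn p) (fn q) k)^*%C).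
    by rewrite (normcM (Num.sqrt _)%:C) exprMn sN.
  by rewrite -[in RHS](opprK k) normal_modeN omegaN; ring.
rewrite /coordX /coordY !normcM !normcV !exprMn !exprVn normcM exprMn si s2.
rewrite expr1n mul1r -mulrDl normc_parallelogram eX eY; field.
by rewrite gt_eqF.
Qed.

(** Mode 0, absent from the phase norm, drops out of [normal_norm] as the total momentum is zero; on
    the other modes the phase weight is the square of [weight]. *)
Lemma phase_norm_normal p q : zero_sum p ->
  phase_norm s sigma (toda_coord p q) =
  Num.sqrt 2^-1 * normal_norm s sigma (fn p) (fn q).
Proof.
move=> hp; rewrite /phase_norm /normal_norm /l2norm -sqrtrM ?invr_ge0 //.
congr Num.sqrt; rewrite [in RHS]big_ord_recl normal_mode_zero // normc0 mulr0 expr0n add0r.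
rewrite !mulr_sumr; apply: eq_bigr => i _.
set k := lift ord0 i.
have kE : i.+1 = k :> nat by [].
have k0 : k != 0 by [].
rewrite !mxE kE -mulrA coord_energy //.
have b1 : (maxn 1 (bracket N k) = bracket N k)%N by apply/maxn_idPr; rewrite bracket_gt0.
rewrite exprMn /weight b1 exprMn -(powR_mulrn 2 (powR_ge0 (bracket N k)%:R s)) -powRrM (mulrC s 2).
have -> : expR (sigma * (bracket N k)%:R) ^+ 2 = expR (2 * sigma * (bracket N k)%:R).
  by rewrite expr2 -expRD; congr expR; ring.
have N0 : N%:R != 0 :> R by rewrite pnatr_eq0.
by field.
Qed.

End PhaseNorm.

(** * Continuity of the norm in time *)

Section Continuity.
Variables (R : realType) (n : nat).
Local Notation I := 'I_n.+2.

Lemma cderivZ (c : R[i]) (f : R -> R[i]) (t : R) df :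
  cderiv f t df -> cderiv (fun u => c * f u) t (c * df).
Proof. by move=> h; have := cderivM (cderiv_cst c t) h; rewrite mul0r add0r. Qed.

Lemma cderiv_conj (f : R -> R[i]) (t : R) df :
  cderiv f t df -> cderiv (fun u => (f u)^*%C) t df^*%C.
Proof.
move=> [h1 h2]; split.
  by apply: is_derive_congr h1 => [u|]; [case: (f u) | case: df {h2}].
by apply: is_derive_congr (is_deriveN h2) => [u|]; [rewrite /= fctE; case: (f u) | case: df {h1 h2}].
Qed.

Lemma cderiv_fourier (x : R -> I -> R) (t : R) (dx : I -> R) k :
  (forall j, is_derive t 1 (fun u => x u j) (dx j)) ->
  cderiv (fun u => fourier (x u) k) t (fourier dx k).
Proof.
move=> h; apply: cderivZ; apply: cderiv_sum => j.
have := cderivM (cderiv_real (h j)) (cderiv_cst (chi R (j * k)) t).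
by rewrite mulr0 addr0.
Qed.

Lemma normal_norm_continuous (s sigma : R) (p q dp dq : R -> I -> R) :
  (forall (t : R) j, is_derive t 1 (fun u => p u j) (dp t j)) ->
  (forall (t : R) j, is_derive t 1 (fun u => q u j) (dq t j)) ->
  continuous (fun t => normal_norm s sigma (p t) (q t)).
Proof.
move=> hp hq.
have hz t k : cderiv (fun u => normal_mode (p u) (q u) k) t
    (normal_mode (dp t) (dq t) k).
  by apply: cderivD; [|apply: cderivZ]; exact: cderiv_fourier.
(* The squared norm is written through products z conj(z), which are differentiable even at zeros of
   the modulus; the square root is taken afterwards and needs only continuity. *)
pose G u : R[i] := \sum_k ((weight s sigma k) ^+ 2)%:C *
  (normal_mode (p u) (q u) k * (normal_mode (p u) (q u) k)^*%C).
have GE u : normal_norm s sigma (p u) (q u) = Num.sqrt (complex.Re (G u)).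
  rewrite /normal_norm /l2norm /G; congr Num.sqrt.
  have -> : \sum_k ((weight s sigma k) ^+ 2)%:C *
      (normal_mode (p u) (q u) k * (normal_mode (p u) (q u) k)^*%C) =
      (\sum_k (weight s sigma k * normc (normal_mode (p u) (q u) k)) ^+ 2)%:C.
    rewrite real_complex_sum; apply: eq_bigr => k _.
    by rewrite mul_conjc_normc -[LHS]real_complexM [in RHS]exprMn.
  by [].
have -> : (fun t => normal_norm s sigma (p t) (q t)) =
    (@Num.sqrt R) \o (fun u => complex.Re (G u)) by apply/funext.
move=> t; apply: continuous_comp; last exact: sqrt_continuous.
apply/differentiable_continuous/derivable1_diffP.
have [h _] : cderiv G t (\sum_k ((weight s sigma k) ^+ 2)%:C *
    (normal_mode (dp t) (dq t) k * (normal_mode (p t) (q t) k)^*%C +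
     normal_mode (p t) (q t) k * (normal_mode (dp t) (dq t) k)^*%C)).
  by apply: cderiv_sum => k; apply/cderivZ/cderivM => //; exact: cderiv_conj.
by case: h.
Qed.

(** The points [a] and [b] are not ordered, since the confinement concerns both directions of
    time. *)
Lemma continuous_crossing (f : R -> R) (a b v : R) :
  continuous f -> f a <= v -> v <= f b -> exists c, f c = v.
Proof.
move=> fc fa fb.
have [ab|/ltW ba] := leP a b.
  have [|c _ fcv] := @IVT R f a b v ab (continuous_subspaceT fc).
    by rewrite ge_min fa le_max fb orbT.
  by exists c.
have [|c _ fcv] := @IVT R f b a v ba (continuous_subspaceT fc).
  by rewrite ge_min fa orbT le_max fb.
by exists c.
Qed.

End Continuity.

(** * Confinement of the solution *)

Section Confinement.
Variables (R : realType) (s sigma : R) (n : nat).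
Hypotheses (hs : 0 <= s) (hsigma : 0 <= sigma).
Local Notation N := n.+2.
Variables (p q : R -> 'rV[R]_n.+2) (r : R).
Hypothesis sol : toda_solution p q.
Hypothesis r_small : r <= (1000 * powR 2 s)^-1.
Let f (t : R) := phase_norm s sigma (toda_coord (p t) (q t)).
Let b : R := r / N%:R ^+ 2.
Hypothesis f0 : f 0 < b.
Let nn (t : R) := normal_norm s sigma (fun j => p t ord0 j) (fun j => q t ord0 j).

Let fE t : f t = Num.sqrt 2^-1 * nn t.
Proof. by have [h _ _] := sol t; rewrite /f phase_norm_normal. Qed.

Let c2 : 0 < powR 2 s :> R. Proof. by rewrite powR_gt0. Qed.

(** Positivity of [r] is not assumed; it follows from the initial bound, the norm being
    nonnegative. *)
Let b0 : 0 < b.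
Proof. by apply: le_lt_trans f0; rewrite sqrtr_ge0. Qed.

Let r0 : 0 < r.
Proof.
have N2 : 0 < (N%:R : R) ^+ 2 by rewrite exprn_gt0 // ltr0n.
by have := b0; rewrite /b pmulr_lgt0 // invr_gt0.
Qed.

Let cr : powR 2 s * r <= 1000^-1.
Proof.
have := r_small; rewrite invfM -(ler_pM2l c2) => /le_trans; apply.
by rewrite mulrCA mulfV ?mulr1 // gt_eqF.
Qed.

Let sqrt_half : 2 / 3 <= Num.sqrt 2^-1 :> R /\ Num.sqrt 2^-1 <= 1 :> R.
Proof.
have s0 : 0 <= Num.sqrt 2^-1 :> R by exact: sqrtr_ge0.
have s2 : Num.sqrt 2^-1 ^+ 2 = 2^-1 :> R by rewrite sqr_sqrtr.
by split; rewrite -(@ler_pXn2r _ 2) ?nnegrE // s2; lra.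
Qed.

(** Since sqrt(1/2) >= 2/3, the normal norm is at most x = 3 b, so that g = 3 * 2^s * r. The
    increment 65 g x is 585 * 2^s * r * b, and rounding up to 600 leaves room. *)
Lemma toda_norm_step t : f t <= 2 * b -> f t < b * (1 + 600 * powR 2 s * r).
Proof.
move=> ft; have [k1 k2] := sqrt_half.
have nn0 u : 0 <= nn u by exact: l2norm_ge0.
have nn_le u : f u <= 2 * b -> nn u <= 3 * b.
  rewrite fE => h; have := ler_wpM2r (nn0 u) k1 => h1; lra.
have N2 : 0 < (N%:R : R) ^+ 2 by rewrite exprn_gt0 // ltr0n.
have gE : powR 2 s * N%:R ^+ 2 * (3 * b) = 3 * (powR 2 s * r).
  rewrite /b; have : (N%:R : R) ^+ 2 != 0 by rewrite gt_eqF.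
  by move: (_ ^+ 2) (powR _ _) => x y x0; field.
have small : powR 2 s * N%:R ^+ 2 * (3 * b) <= 40^-1.
  rewrite gE; have := cr; lra.
have f0b : f 0 <= 2 * b by have := f0; have := b0; lra.
have [hp _ _] := sol t.
have := normal_norm_comparison hs hsigma hp (nn_le t ft) (nn_le 0 f0b) small
  (fun k lam => @toda_isospectral _ _ _ _ sol _ t 0 lam (cis_mulC _)).
rewrite gE -/(nn t) -/(nn 0) => h.
have e0 : 0 <= 65 * (3 * (powR 2 s * r) * (3 * b)).
  by rewrite !mulr_ge0 // ltW.
have h1 : f t <= f 0 + 65 * (3 * (powR 2 s * r) * (3 * b)).
  rewrite !fE; apply: le_trans (ler_wpM2l (sqrtr_ge0 _) h) _.
  by rewrite mulrDr lerD2l ler_piMl.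
apply: le_lt_trans h1 _.
have e1 : 0 < powR 2 s * r * b by rewrite !mulr_gt0.
move: e1 f0; rewrite -/b.
have -> : 65 * (3 * (powR 2 s * r) * (3 * b)) = 585 * (powR 2 s * r * b) by ring.
have -> : b * (1 + 600 * powR 2 s * r) = b + 600 * (powR 2 s * r * b) by ring.
by move: (powR 2 s * r * b) => t1 h2 h3; lra.
Qed.

(* A continuous curve leaving the ball of radius 2 b would cross its boundary,
   which the self-improving bound [toda_norm_step] forbids. *)
Lemma toda_norm_confined t : f t < b * (1 + 600 * powR 2 s * r).
Proof.
have h0 : 600 * powR 2 s * r <= 1.
  by rewrite -mulrA; have := cr; move: (_ * r) => y h; lra.
have f0b : f 0 <= 2 * b by have := f0; have := b0; lra.
have [|ft] := leP (f t) (2 * b); first exact: toda_norm_step.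
have fc : continuous f.
  have -> : f = fun u => Num.sqrt 2^-1 * nn u by apply/funext => u; exact: fE.
  move=> u; apply: cvgMr.
  apply: (normal_norm_continuous (dp := fun t j =>
     flaschka (fun j => q t ord0 j) (j - 1) ^+ 2 - flaschka (fun j => q t ord0 j) j ^+ 2)
     (dq := fun t j => p t ord0 j)) => x j.
    exact: toda_is_derive_p.
  exact: toda_is_derive_q.
have [c fcE] := continuous_crossing fc f0b (ltW ft).
have := toda_norm_step (t := c); rewrite fcE lexx => /(_ isT).
have h1 : b * (1 + 600 * powR 2 s * r) <= 2 * b.
  rewrite (mulrC 2) ler_wpM2l ?(ltW b0) //.
  by rewrite (_ : 2 = 1 + 1) ?lerD2l //; ring.
by move=> /lt_le_trans /(_ h1); rewrite ltxx.
Qed.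

End Confinement.

Theorem corollary1p4 (R : realType) (s sigma : R) (hs : 0 <= s)
    (hsigma : 0 <= sigma) :
  exists Rs Cs : R, [/\ 0 < Rs, 0 < Cs &
    forall (N : nat), (2 <= N)%N ->
    forall (r : R), r <= Rs ->
    forall (p q : R -> 'rV[R]_N), toda_solution p q ->
      phase_ball s sigma (r / N%:R ^+ 2) (toda_coord (p 0) (q 0)) ->
    forall t : R,
      phase_ball s sigma (r / N%:R ^+ 2 * (1 + Cs * r))
        (toda_coord (p t) (q t))].
Proof.
have c2 : 0 < powR 2 s :> R by rewrite powR_gt0.
(* The step needs 3 * 2^s * r <= 1/40, and the confinement needs 600 * 2^s * r <= 1 so that the
   improved bound stays within 2 b; this radius satisfies both. *)
exists (1000 * powR 2 s)^-1, (600 * powR 2 s).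
have Rs0 : 0 < (1000 * powR 2 s)^-1 :> R by rewrite invr_gt0 pmulr_rgt0 ?ltr0n.
have Cs0 : 0 < 600 * powR 2 s :> R by rewrite pmulr_rgt0 ?ltr0n.
split; [exact: Rs0 | exact: Cs0 |].
case=> [|[|n]] // _ r hr p q sol h0 t.
exact: toda_norm_confined.
Qed.
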